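(* Let $G=(V,E)$ be a graph containing a cycle and having no isolated vertices, with vertex costs $c:V\to\mathbb{R}_{\ge 0}$. Then there exists an extreme point $(x,y)$ of $Q'_{\mathrm{orient}}(G)$ that is an optimum solution of $\min\{c^Tx:(x,y)\in Q'_{\mathrm{orient}}(G)\}$ and such that at least one of the coordinates of $x$ has value at least $1/2$.
   Context: Graphs are finite, undirected, simple and loopless. For $G$ without isolated vertices, $Q'_{\mathrm{orient}}(G)$ is the set of points $(x,y)$, with variables $x_v$ ($v\in V$) and $y^f_{e,v}$ ($f\in E$, $e\in E$, $v$ an endpoint of $e$), satisfying - $x_v+x_w+y^f_{e,v}+y^f_{e,w}\ge 1$ for all $e=vw\in E$ and $f\in E$; - $x_v+\sum_{e=vw\in E}y^f_{e,w}\ge 1$ for all $v\in V$ and $f\in E$ (the sum is over edges $e$ incident to $v$, with $w$ the other endpoint of $e$); - $\sum_{v\in V\setminus\{a,b\}}x_v+\sum_{e=vw\in E\setminus\{f\}}(y^f_{e,w}+y^f_{e,v})\le |V|-2$ for all $f=ab\in E$; - $y^f_{e,v}\ge 0$ for all $v\in V$, $e\in E$ incident to $v$, $f\in E$; - $0\le x_u\le 1$ for all $u\in V$. *)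

(* Defs.v *)
(* MathComp, with classical sets and realType from MathComp-Analysis. *)
From mathcomp Require Import all_boot all_order all_algebra.
From mathcomp Require Import boolp classical_sets reals.

Set Implicit Arguments.
Unset Strict Implicit.
Unset Printing Implicit Defensive.

Import Order.TTheory GRing.Theory Num.Theory.
Local Open Scope ring_scope.

Record sgraph := SGraph {
  vertex :> finType;
  adj : rel vertex;
  adj_sym : symmetric adj;
  adj_irrefl : irreflexive adj
}.

Definition no_isolated (G : sgraph) : Prop :=
  forall v : G, exists w : G, adj v w.

Definition has_cycle (G : sgraph) : Prop :=
  exists s : seq G, (2 < size s)%N /\ ucycle (@adj G) s.

Definition edge_set (G : sgraph) : {set {set G}} :=
  [set [set p.1; p.2] | p : G * G & adj p.1 p.2].

Definition edge (G : sgraph) := {e : {set G} | e \in edge_set G}.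

(* The pairs (e, v) with v an endpoint of the edge e: every edge e = vw carries
   exactly the two flags (e, v) and (e, w). *)
Definition flag (G : sgraph) := {p : edge G * G | p.2 \in val p.1}.

Definition flag_edge (G : sgraph) (h : flag G) : edge G := (val h).1.
Definition flag_vertex (G : sgraph) (h : flag G) : G := (val h).2.

(* A point (x, y): p.1 v is x_v, and p.2 (f, h) is y^f_{e,v} for the flag
   h = (e, v). There is no coordinate y^f_{e,v} for v not in e. *)
Definition orient_space (R : realType) (G : sgraph) : lmodType R :=
  ({ffun G -> R^o} * {ffun edge G * flag G -> R^o})%type.

Section Qorient.
Variables (R : realType) (G : sgraph).
Implicit Types (x : {ffun G -> R^o}) (y : {ffun edge G * flag G -> R^o}).

Definition edge_constraints x y : Prop :=
  forall e f : edge G,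
    1 <= \sum_(v in val e) x v + \sum_(h | flag_edge h == e) y (f, h).

(* The flags summed over are the (e, w) with e = vw incident to v, so that each
   such e contributes the variable of its endpoint other than v. *)
Definition vertex_constraints x y : Prop :=
  forall (v : G) (f : edge G),
    1 <= x v + \sum_(h | (v \in val (flag_edge h)) && (flag_vertex h != v))
                 y (f, h).

Definition total_constraints x y : Prop :=
  forall f : edge G,
    \sum_(v | v \notin val f) x v + \sum_(h | flag_edge h != f) y (f, h)
      <= #|G|%:R - 2%:R.

Definition Qorient' : set (orient_space R G) :=
  [set p | [/\ edge_constraints p.1 p.2,
               vertex_constraints p.1 p.2,
               total_constraints p.1 p.2,
               (forall f h, 0 <= p.2 (f, h)) &
               (forall u, 0 <= p.1 u <= 1)]]%classic.

End Qorient.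
Arguments Qorient' : clear implicits.

Definition extreme_point (R : realType) (V : lmodType R) (A : set V) (p : V) :=
  A p /\
  forall (a b : V) (t : R), A a -> A b -> 0 < t < 1 ->
    p = t *: a + (1 - t) *: b -> a = p /\ b = p.

Definition cost (R : realType) (G : sgraph) (c : G -> R)
    (p : orient_space R G) : R :=
  \sum_(v : G) c v * p.1 v.

Definition optimal (R : realType) (V : Type) (obj : V -> R) (A : set V)
    (p : V) : Prop :=
  A p /\ forall q, A q -> obj p <= obj q.

(* Main.v *)
Require Import Defs.
From mathcomp Require Import all_boot all_order all_algebra.
From mathcomp Require Import boolp classical_sets reals.
From mathcomp Require Import ring lra zify.
(* Required again so that the names of the finite-set lemmas are not shadowed by
   those of [classical_sets]. *)
From mathcomp Require Import fintype finset.

Set Implicit Arguments.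
Unset Strict Implicit.
Unset Printing Implicit Defensive.
Import Order.TTheory GRing.Theory Num.Theory.
Local Open Scope ring_scope.

(** Among the optimal points, an extreme point [(x, y)] maximising [|x|^2] exists,
    since a concave function bounded below on a line-free polyhedron is minimised
    at an extreme point. It suffices to show that if all [x_v < 1/2], then [x + d]
    and [x - d] both lift to Q'_orient for some [d <> 0]: both are then optimal and
    one of them has larger norm.

    When all [x_v < 1/2], [x] lifts to Q'_orient iff for all [S] with at least two
    vertices
      slack x S = \sum_(v in S) (1 - x_v)
                  - \sum_(vw edge in S) (1 - x_v - x_w) - 1 >= 0;
    the lift orients, fractionally and for each [f = ab], the edges other than [f]
    so that [v] bears load [1 - x_v] if [v <> a, b], and load 0 otherwise.

    Since edges have positive weight [1 - x_v - x_w], two tight sets meeting in at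
    least two vertices can be uncrossed, while counting weights in a family of
    tight sets pairwise meeting in at most one vertex bounds the total size of its
    members. Hence, by induction on [S], the constraints of the tight sets inside a
    nontrivial tight set [S] have rank at most the number of nonzero coordinates in
    [S] minus two; so the tight constraints do not determine [x]. *)

(** * Extreme points minimising a concave function *)

(** Serves to choose steps that violate no strict constraint: [a] holds the available room and [b]
    the rates of change. *)
Lemma uniform_small_step (R : realFieldType) (I : finType) (a b : I -> R) :
  (forall i, 0 < a i) ->
  exists2 eps : R, 0 < eps & forall i, eps * `|b i| < a i.
Proof.
move=> a_gt0.
have b1 i : 0 < 1 + `|b i| by rewrite ltr_pwDl ?normr_ge0.
exists (\big[Num.min/1]_i (a i / (1 + `|b i|))).
  apply: (big_ind (fun z => 0 < z)) => // [y z y0 z0|i _].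
    by rewrite lt_min y0.
  by rewrite divr_gt0.
move=> i; have : \big[Num.min/1]_j (a j / (1 + `|b j|)) <= a i / (1 + `|b i|).
  exact: bigmin_le_cond.
rewrite ler_pdivlMr // => le_a; apply: lt_le_trans le_a.
rewrite ltr_pM2l; first by rewrite ltrDr.
apply: (big_ind (fun z => 0 < z)) => // [y z y0 z0|j _].
  by rewrite lt_min y0.
by rewrite divr_gt0.
Qed.

Section Polyhedron.
Variables (R : realType) (V : lmodType R).
Implicit Types (a b p q : V) (s t : R).

Definition line a b t : V := t *: a + (1 - t) *: b.

Definition affine (L : V -> R) :=
  forall a b t, L (line a b t) = t * L a + (1 - t) * L b.

Definition polyhedron (I : Type) (L : I -> V -> R) : set V :=
  [set p | forall i, 0 <= L i p]%classic.

Definition concave_on (A : set V) (phi : V -> R) := forall a b t,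
  A a -> A b -> 0 <= t <= 1 -> A (line a b t) ->
  t * phi a + (1 - t) * phi b <= phi (line a b t).

Lemma line_line a b s0 s1 t :
  line (line a b s0) (line a b s1) t = line a b (t * s0 + (1 - t) * s1).
Proof.
rewrite /line !scalerDr !scalerA addrACA -!scalerDl.
by congr (_ *: _ + _ *: _); ring.
Qed.

Lemma line_sym a b t : line a b t = line b a (1 - t).
Proof. by rewrite /line subKr addrC. Qed.

Lemma line0 a b : line a b 0 = b.
Proof. by rewrite /line scale0r subr0 scale1r add0r. Qed.

Lemma line_id a t : line a a t = a.
Proof. by rewrite /line -scalerDl addrC subrK scale1r. Qed.

Section FiniteSystem.
Variables (I : finType) (L : I -> V -> R).
Hypothesis L_affine : forall i, affine (L i).
Hypothesis L_inj : forall a b, (forall i, L i a = L i b) -> a = b.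
Let A := polyhedron L.

Definition loose p := [set i | L i p != 0].

(** Move past [b], away from [a], until a first constraint reaches 0. Constraints tight strictly
    between [a] and [b] vanish at both points, hence on the whole line, so none is lost. *)
Lemma hit_boundary a b t : A a -> A b -> 0 < t < 1 ->
  (exists i, L i b < L i a) ->
  exists s, [/\ s <= 0, A (line a b s) &
                (#|loose (line a b s)| < #|loose (line a b t)|)%N].
Proof.
move=> Aa Ab /andP[t0 t1] [i0 lt_i0].
(* [r i] is the parameter where [L i] vanishes; the largest one is met first when the parameter
   decreases from 0. *)
pose r i := - L i b / (L i a - L i b).
have [i lt_i r_max] := @arg_maxP _ _ _ i0 (fun i => L i b < L i a) r lt_i0.
have r_le0 j : L j b < L j a -> r j <= 0.
  move=> ltj; rewrite /r mulNr oppr_le0 divr_ge0 ?Ab //.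
  by rewrite subr_ge0 ltW.
exists (r i); split; first exact: r_le0.
  move=> j; rewrite L_affine.
  have [ltj|lej] := ltP (L j b) (L j a).
    have : - L j b <= r i * (L j a - L j b).
      by rewrite -ler_pdivrMr ?subr_gt0 //; exact: r_max.
    lra.
  have := r_le0 i lt_i; have := Ab j; have := Aa j; nra.
have nz j : L j (line a b t) = 0 -> L j a = 0 /\ L j b = 0.
  by rewrite L_affine; have := Aa j; have := Ab j; split; nra.
apply: proper_card; apply/properP; split.
  apply/subsetP => j; rewrite !inE; apply: contra => /eqP/nz[ja jb].
  by rewrite L_affine ja jb !mulr0 addr0.
exists i; rewrite !inE.
  by apply/eqP => /nz[ia ib]; move: lt_i; rewrite ia ib ltxx.
rewrite negbK L_affine; apply/eqP.
have : r i * (L i a - L i b) = - L i b by rewrite divfK // subr_eq0 gt_eqF.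
lra.
Qed.

Lemma ray_in a b s : A a -> A b -> (forall i, L i b <= L i a) -> 0 <= s ->
  A (line a b s).
Proof.
move=> Aa Ab le_ba s0 i; rewrite L_affine.
have := le_ba i; have := Aa i; have := Ab i; nra.
Qed.

Variables (phi : V -> R) (m : R).
Hypothesis phi_concave : concave_on A phi.
Hypothesis phi_bounded : forall p, A p -> m <= phi p.

(** After a decrease, a concave function keeps falling at least linearly along the ray, against the
    lower bound [m]. *)
Lemma concave_ray a b s t : A a -> A b -> s <= 0 -> A (line a b s) -> 0 < t ->
  (forall i, L i b <= L i a) -> phi (line a b s) <= phi (line a b t).
Proof.
move=> Aa Ab s0 As t0 le_ba; rewrite leNgt; apply/negP => lt_phi.
set D := phi (line a b s) - phi (line a b t).
have D0 : 0 < D by rewrite subr_gt0.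
have At : A (line a b t) by apply: ray_in => //; exact: ltW.
have M0 : 0 <= phi (line a b t) - m by rewrite subr_ge0 phi_bounded.
(* With this [k], concavity would give [phi (line a b u) <= m - 1]. *)
pose k := 1 + (phi (line a b t) - m + 1) / D.
have k1 : 1 < k by rewrite /k ltrDl divr_gt0 //; lra.
have k0 : 0 < k by lra.
pose u := s + k * (t - s).
have Au : A (line a b u) by apply: ray_in => //; rewrite /u; nra.
have Et : k^-1 * u + (1 - k^-1) * s = t by rewrite /u; field; rewrite gt_eqF.
have ki1 : 0 <= k^-1 <= 1 by rewrite invr_ge0 (ltW k0) invf_le1 // ltW.
have := phi_concave Au As ki1; rewrite line_line Et => /(_ At).
have -> : k^-1 * phi (line a b u) + (1 - k^-1) * phi (line a b s)
    = k^-1 * (phi (line a b u) + (k - 1) * phi (line a b s)).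
  by field; rewrite gt_eqF.
rewrite mulrC ler_pdivrMr // => le_u.
have kD : (k - 1) * D = phi (line a b t) - m + 1.
  by rewrite /k addrC addKr divfK // gt_eqF.
have := phi_bounded Au; move: kD; rewrite /D; nra.
Qed.

(** Induction on the number of loose constraints. The line of a segment with [p] in its interior
    meets the boundary. If it does so on both sides, concavity makes one of the two hits at least as
    good as [p]; if on one side only, [concave_ray] does so for that hit. *)
Lemma improve_to_extreme p : A p -> exists2 q, extreme_point A q & phi q <= phi p.
Proof.
have [n] := ubnP #|loose p|; elim: n p => // n IH p /ltnSE len Ap.
have [|np] := pselect (extreme_point A p); first by exists p.
have step a b t : A a -> A b -> 0 < t < 1 -> p = line a b t ->
    (exists i, L i b < L i a) -> exists2 q, extreme_point A q & phi q <= phi p.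
  move=> Aa Ab t01 Ep exi.
  have [s [s0 As lts]] := hit_boundary Aa Ab t01 exi.
  rewrite -Ep in lts.
  have [|phi_s] := leP (phi (line a b s)) (phi p).
    have [q xq lq] := IH _ (leq_trans lts len) As.
    by exists q => //; exact: le_trans lq _.
  have [le_ba|] := pselect (forall i, L i b <= L i a).
    have := @concave_ray a b s t Aa Ab s0 As _ le_ba.
    by rewrite -Ep leNgt phi_s => /(_ (proj1 (andP t01))).
  move=> /existsNP[i /negP]; rewrite -ltNge => lti.
  have t01' : 0 < 1 - t < 1 by case/andP: t01 => ? ?; apply/andP; split; lra.
  have [s' [s'0 As' lts']] := hit_boundary Ab Aa t01' (ex_intro _ i lti).
  rewrite -line_sym -Ep in lts'.
  have [q xq lq] := IH _ (leq_trans lts' len) As'.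
  exists q => //; apply: le_trans lq _.
  (* Both hits are now on the same parametrisation, with [p] between them; the hit at [s] is worse
     than [p], so the one at [u] is not. *)
  rewrite line_sym in As' *; set u := 1 - s' in As' *.
  have u1 : 1 <= u by rewrite /u; lra.
  have us : 0 < u - s by lra.
  pose k := (u - t) / (u - s).
  case/andP: t01 => t0 t1.
  have k01 : 0 <= k < 1.
    by rewrite divr_ge0 /= ?ltr_pdivrMr //; lra.
  case/andP: k01 => k0 k1.
  have Et : k * s + (1 - k) * u = t by rewrite /k; field; rewrite gt_eqF.
  have k01 : 0 <= k <= 1 by rewrite k0 ltW.
  have := phi_concave As As' k01; rewrite line_line Et -Ep => /(_ Ap).
  have : 0 < 1 - k by lra.
  move: phi_s; nra.
have : ~ (forall a b t, A a -> A b -> 0 < t < 1 -> p = line a b t -> a = p /\ b = p).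
  by move=> h; apply: np.
move=> /existsNP[a /existsNP[b /existsNP[t]]].
move=> /not_implyP[Aa /not_implyP[Ab /not_implyP[t01 /not_implyP[Ep nab]]]].
have [eqL|] := pselect (forall i, L i a = L i b).
  by case: nab; rewrite Ep (L_inj eqL) line_id.
move=> /existsNP[i /eqP]; rewrite neq_lt => /orP[lt_i|lt_i].
  apply: (step b a (1 - t)) => //; last by exists i.
    by case/andP: t01 => ? ?; apply/andP; split; lra.
  by rewrite -line_sym.
by apply: (step a b t) => //; exists i.
Qed.

(** Otherwise the segment from [q] to [p] extends a little past [p], which makes [p] interior. Hence
    there are finitely many extreme points, indexed by their loose sets. *)
Lemma extreme_loose_inj p q :
  extreme_point A p -> A q -> loose p = loose q -> p = q.
Proof.
move=> [Ap xp] Aq Epq.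
have [|eps eps0 small] := @uniform_small_step R I
    (fun i => if L i p == 0 then 1 else L i p) (fun i => L i q - L i p).
  by move=> i; case: eqP => // /eqP nz; rewrite lt_neqAle eq_sym nz Ap.
pose a := line p q (1 + eps).
have Aa : A a.
  move=> i; rewrite L_affine; have := small i.
  case: eqP => [p0 _|_].
    have : i \notin loose q by rewrite -Epq inE p0 eqxx.
    by rewrite inE negbK => /eqP ->; rewrite p0 !mulr0 addr0.
  have : L i q - L i p <= `|L i q - L i p| := ler_norm _.
  nra.
have e1 : 0 < 1 + eps by lra.
have t01 : 0 < (1 + eps)^-1 < 1.
  by rewrite invr_gt0 e1 invf_lt1 //; lra.
have Ep : p = line a q (1 + eps)^-1.
  rewrite -[X in line a X _](line0 p q) /a line_line mulr0 addr0.
  by rewrite mulVf ?gt_eqF // /line subrr scale0r scale1r addr0.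
by have [] := xp _ _ _ Aa Aq t01 Ep.
Qed.

Lemma concave_min_extreme : (exists p, A p) ->
  exists2 p, extreme_point A p & forall q, A q -> phi p <= phi q.
Proof.
move=> [p0 Ap0].
pose P T := exists2 p, extreme_point A p & loose p = T.
(* [p0] is a dummy for the sets that no extreme point realises. *)
pose sel T := if pselect (P T) is left h then s2val (cid2 h) else p0.
have [q0 xq0 _] := improve_to_extreme Ap0.
have PT0 : `[< P (loose q0) >] by apply/asboolP; exists q0.
have [T PT minT] := @arg_minP _ _ _ (loose q0) (fun T => `[< P T >])
  (fun T => phi (sel T)) PT0.
have selP T' : P T' -> extreme_point A (sel T') /\ loose (sel T') = T'.
  by rewrite /sel; case: pselect => // h _; case: cid2.
have [xT lT] := selP _ (asboolW PT).
exists (sel T) => // q Aq.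
have [q1 xq1 le1] := improve_to_extreme Aq.
have Pq1 : P (loose q1) by exists q1.
apply: le_trans le1.
have [x1 l1] := selP _ Pq1.
have := minT (loose q1) (asboolT Pq1).
by rewrite -(extreme_loose_inj xq1 (proj1 x1) (esym l1)).
Qed.

End FiniteSystem.

(** The second minimisation runs over the face of minimisers of [f], cut out by the added constraint
    [f p0 - f p >= 0]. An extreme point of this face is extreme in [A]: a segment of [A] with that
    point in its interior cannot leave the face. *)
Lemma lex_min_extreme (I : finType) (L : I -> V -> R) (f phi : V -> R)
    (m n : R) (A := polyhedron L) :
  (forall i, affine (L i)) ->
  (forall a b, (forall i, L i a = L i b) -> a = b) ->
  affine f -> (forall p, A p -> m <= f p) ->
  concave_on A phi -> (forall p, A p -> n <= phi p) ->
  (exists p, A p) ->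
  exists p, [/\ extreme_point A p, forall q, A q -> f p <= f q &
                forall q, A q -> f q <= f p -> phi p <= phi q].
Proof.
move=> L_aff L_inj f_aff f_bd phi_cc phi_bd A_ne.
have f_cc : concave_on A f by move=> a b t _ _ _ _; rewrite f_aff.
have [p0 [Ap0 _] p0_min] := concave_min_extreme L_aff L_inj f_cc f_bd A_ne.
pose L' (i : option I) p := if i is Some j then L j p else f p0 - f p.
have L'A p : polyhedron L' p <-> A p /\ f p <= f p0.
  split=> [h|[Ap le0]].
    split=> [i|]; first exact: (h (Some i)).
    by rewrite -subr_ge0; exact: (h None).
  by case=> [i|] /=; [exact: Ap | rewrite subr_ge0].
have L'_aff i : affine (L' i).
  by case: i => [i|] a b t /=; [rewrite L_aff | rewrite f_aff; ring].
have L'_inj a b : (forall i, L' i a = L' i b) -> a = b.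
  by move=> h; apply: L_inj => i; exact: (h (Some i)).
have cc' : concave_on (polyhedron L') phi.
  by move=> a b t /L'A[? _] /L'A[? _] ? /L'A[? _]; exact: phi_cc.
have bd' p : polyhedron L' p -> n <= phi p by move=> /L'A[? _]; exact: phi_bd.
have [|p [/L'A[Ap fp] xp] p_min] :=
    concave_min_extreme L'_aff L'_inj cc' bd' (ex_intro _ p0 _).
  by apply/L'A.
exists p; split.
- split=> // a b t Aa Ab t01 Ep.
  have fE : f p = t * f a + (1 - t) * f b by rewrite Ep f_aff.
  have := p0_min _ Aa; have := p0_min _ Ab => fa fb.
  apply: (xp a b t) => //; apply/L'A; split=> //; case/andP: t01; nra.
- by move=> q Aq; apply: le_trans fp (p0_min _ Aq).
- move=> q Aq fq; apply: p_min; apply/L'A; split => //; exact: le_trans fq fp.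
Qed.

End Polyhedron.

(** * Fractional orientations *)

Lemma sum_setUI (R : nmodType) (V : finType) (h : V -> R) (S T : {set V}) :
  \sum_(v in S) h v + \sum_(v in T) h v
  = \sum_(v in S :|: T) h v + \sum_(v in S :&: T) h v.
Proof.
rewrite ![\sum_(v in _) _]big_mkcond -!big_split /=; apply: eq_bigr => v _.
by rewrite !inE; case: (v \in S); case: (v \in T); rewrite /= ?addr0 ?add0r.
Qed.

Section Orientation.
Variables (R : realFieldType) (V : finType) (E : eqType).
Variables (src tgt : E -> V) (w : E -> R).
Hypothesis w_ge0 : forall e, 0 <= w e.

Definition inner (S : {set V}) e := (src e \in S) && (tgt e \in S).

(** Capacity minus demand: edges inside [S] can charge only vertices of [S], so nonnegativity on all
    sets is Hakimi's condition for an orientation. *)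
Definition surplus (s : V -> R) (l : seq E) (S : {set V}) :=
  \sum_(v in S) s v - \sum_(e <- l | inner S e) w e.

Lemma surplus_setUI s l S T :
  surplus s l (S :|: T) + surplus s l (S :&: T) <= surplus s l S + surplus s l T.
Proof.
have sUI := sum_setUI s S T.
suff : \sum_(e <- l | inner S e) w e + \sum_(e <- l | inner T e) w e
  <= \sum_(e <- l | inner (S :|: T) e) w e + \sum_(e <- l | inner (S :&: T) e) w e.
  rewrite /surplus; lra.
rewrite ![\sum_(e <- _ | inner _ _) _]big_mkcond -!big_split /=; apply: ler_sum => e _.
rewrite /inner !inE; have := w_ge0 e.
by case: (src e \in S); case: (src e \in T); case: (tgt e \in S);
  case: (tgt e \in T); rewrite /=; lra.
Qed.

(* Greedy choice: the first edge charges its source as much as the tight sets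
   around the source allow; by submodularity of [surplus] its target can then
   bear the rest. *)
Lemma fractional_orientation (s : V -> R) (l : seq E) : uniq l ->
  (forall S, 0 <= surplus s l S) ->
  exists z : E -> R, (forall e, 0 <= z e <= w e) /\
    forall v, \sum_(e <- l | src e == v) z e + \sum_(e <- l | tgt e == v) (w e - z e)
              <= s v.
Proof.
elim: l s => [|e l IH] s /=.
  move=> _ h; exists (fun=> 0); split=> [e|v]; first by rewrite lexx w_ge0.
  have := h [set v]; rewrite /surplus big_set1 !big_nil; lra.
case/andP => el ul hs; set a := src e; set b := tgt e.
have consE S : surplus s (e :: l) S = surplus s l S - (if inner S e then w e else 0).
  by rewrite /surplus big_cons; case: ifP => _; lra.
pose t := Num.min (w e) (\big[Num.min/w e]_(S : {set V} | a \in S) surplus s l S).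
have hs0 S : 0 <= surplus s l S.
  by have := hs S; rewrite consE; case: ifP; have := w_ge0 e; lra.
have t_le_w : t <= w e by rewrite ge_min lexx.
have t_le (S : {set V}) : a \in S -> t <= surplus s l S.
  by move=> aS; rewrite ge_min bigmin_le_cond ?orbT.
have t_ge0 : 0 <= t.
  rewrite le_min w_ge0 /=; apply: (big_ind (fun r => 0 <= r)) => //.
  by move=> p q p0 q0; rewrite le_min p0.
have t_cases : t = w e \/ exists2 S : {set V}, a \in S & surplus s l S = t.
  have : \big[Num.min/w e]_(S : {set V} | a \in S) surplus s l S = w e \/
      exists2 S : {set V}, a \in S &
        surplus s l S = \big[Num.min/w e]_(S : {set V} | a \in S) surplus s l S.
    apply: (big_ind (fun r => r = w e \/ exists2 S : {set V}, a \in S & surplus s l S = r)).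
    - by left.
    - by move=> p q hp hq; rewrite /Num.min; case: ifP.
    - by move=> S aS; right; exists S.
  rewrite /t; move: (\big[_/_]_(_ | _) _) => m h.
  by case: (leP (w e) m) => _; [left | case: h => [->|h]; [left | right]].
pose s' v := s v - (v == a)%:R * t - (v == b)%:R * (w e - t).
have s'E S : surplus s' l S
    = surplus s l S - (a \in S)%:R * t - (b \in S)%:R * (w e - t).
  have pick_sum c r : \sum_(v in S) (v == c)%:R * r = (c \in S)%:R * r :> R.
    rewrite big_mkcond (bigD1 c) //= eqxx mul1r big1 ?addr0.
      by case: (c \in S); rewrite ?mul1r ?mul0r.
    by move=> v /negbTE ->; rewrite mul0r if_same.
  by rewrite /surplus /s' !sumrB !pick_sum; lra.
have [|z [z01 zs]] := IH s' ul.
  move=> S; rewrite s'E; have := hs S; rewrite consE /inner -/a -/b.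
  have := hs0 S; have := t_le S.
  case: (boolP (a \in S)) => aS; case: (boolP (b \in S)) => bS /=;
    rewrite ?mul1r ?mul0r; try by move=> h; have := h isT; lra.
    2: by move=> _ S0 _; lra.
  (* Here [b] is in [S] and [a] is not. If the set [T] that limits [t] contains [b], it contains
     both ends of [e], which forces [t = w e]; otherwise [S :|: T] contains both, and submodularity
     leaves at least [w e - t] at [S]. *)
  move=> _ S0 _; case: t_cases => [->|[T aT tT]]; first by lra.
  have [bT|bT] := boolP (b \in T).
    by have := hs T; rewrite consE /inner -/a -/b aT bT tT /=; lra.
  have := surplus_setUI s l S T; have := hs0 (S :&: T); have := hs (S :|: T).
  rewrite consE /inner -/a -/b !inE aT bS orbT /= tT; lra.
exists (fun e' => if e' == e then t else z e'); split.
  by move=> e'; case: eqP => [->|_]; rewrite ?t_ge0 ?z01.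
move=> v; rewrite !big_cons eqxx -/a -/b.
have zl (P : pred E) (F : R -> E -> R) :
    \sum_(e' <- l | P e') F (if e' == e then t else z e') e'
    = \sum_(e' <- l | P e') F (z e') e'.
  rewrite big_seq_cond [RHS]big_seq_cond; apply: eq_bigr => e' /andP[el' _].
  by case: eqP => // Ee; rewrite Ee (negbTE el) in el'.
rewrite (zl _ (fun r _ => r)) (zl _ (fun r e' => w e' - r)).
have := zs v; rewrite /s' ![v == _]eq_sym.
by case: (a == v); case: (b == v); rewrite ?mul1r ?mul0r; lra.
Qed.
End Orientation.

(** * Tight sets at a point with all coordinates below 1/2 *)

Section Slack.
Variables (R : realFieldType) (V E : finType) (ends : E -> {set V}).
Hypothesis card_ends : forall e, #|ends e| = 2%N.
Implicit Types (S T : {set V}) (x d : V -> R).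

Definition edge_weight x (e : E) : R := 1 - \sum_(v in ends e) x v.

Definition slack x S : R :=
  \sum_(v in S) (1 - x v) - \sum_(e | ends e \subset S) edge_weight x e - 1.

Definition deg S v := #|[set e | (v \in ends e) && (ends e \subset S)]|.

Lemma sum_inner_edges (h : V -> R) S :
  \sum_(e | ends e \subset S) \sum_(v in ends e) h v
  = \sum_(v in S) (deg S v)%:R * h v.
Proof.
rewrite (exchange_big_dep (mem S)) /=; last first.
  by move=> e v /subsetP sub /sub.
apply: eq_bigr => v vS; rewrite sumr_const mulr_natl; congr (_ *+ _).
by rewrite /deg cardsE; apply: eq_card => e; rewrite !unfold_in /= andbC.
Qed.

Lemma edge_weightE x e : edge_weight x e = \sum_(v in ends e) (2^-1 - x v).
Proof.
rewrite /edge_weight sumrB sumr_const card_ends mulr2n; congr (_ - _); lra.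
Qed.

Lemma slackE x S :
  slack x S = \sum_(v in S) (1 - x v - (deg S v)%:R * (2^-1 - x v)) - 1.
Proof.
rewrite /slack [in RHS]sumrB -sum_inner_edges.
by congr (_ - _ - _); apply: eq_bigr => e _; exact: edge_weightE.
Qed.

Lemma slack_shift x d S :
  slack (fun v => x v + d v) S
  = slack x S + \sum_(v in S) ((deg S v)%:R - 1) * d v.
Proof.
rewrite !slackE addrAC -big_split /=; congr (_ - _).
by apply: eq_bigr => v _; ring.
Qed.

Definition cross S T e :=
  [&& ends e \subset S :|: T, ~~ (ends e \subset S) & ~~ (ends e \subset T)].

Lemma sum_inner_edges_setUI (h : E -> R) S T :
  \sum_(e | ends e \subset S) h e + \sum_(e | ends e \subset T) h e
  + \sum_(e | cross S T e) h e
  = \sum_(e | ends e \subset S :|: T) h e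
    + \sum_(e | ends e \subset S :&: T) h e.
Proof.
rewrite ![\sum_(e | ends e \subset _) _]big_mkcond [\sum_(e | cross _ _ e) _]big_mkcond.
rewrite -!big_split /=; apply: eq_bigr => e _.
rewrite /cross subsetI.
have [sS|nS] := boolP (ends e \subset S); have [sT|nT] := boolP (ends e \subset T);
  rewrite ?(subset_trans sS (subsetUl _ _)) ?(subset_trans sT (subsetUr _ _)) /=;
  rewrite ?andbF ?andbT ?addr0 ?add0r //.
Qed.

(** Submodularity with its exact defect: the constants cancel, and only edges joining [S :\: T] to
    [T :\: S] are left over. *)
Lemma slack_setUI x S T :
  slack x S + slack x T
  = slack x (S :|: T) + slack x (S :&: T)
    + \sum_(e | cross S T e) edge_weight x e.
Proof.
have := sum_inner_edges_setUI (edge_weight x) S T.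
have := sum_setUI (fun v => 1 - x v) S T.
rewrite /slack; lra.
Qed.

Lemma degS S T v : S \subset T -> (deg S v <= deg T v)%N.
Proof.
move=> sST; apply/subset_leq_card/subsetP => e; rewrite !inE => /andP[-> /=].
by move/subset_trans; apply.
Qed.

Lemma deg_setUI S T v : (forall e, ~~ cross S T e) ->
  (deg S v + deg T v = deg (S :|: T) v + deg (S :&: T) v)%N.
Proof.
move=> nc; rewrite /deg -cardsUI; congr (_ + _)%N.
  apply: eq_card => e; rewrite !inE -andb_orr; congr (_ && _).
  have := nc e; rewrite /cross.
  have [sS|nS] := boolP (ends e \subset S).
    by rewrite (subset_trans sS (subsetUl _ _)).
  have [sT|nT] := boolP (ends e \subset T).
    by rewrite (subset_trans sT (subsetUr _ _)).
  by rewrite !andbT => /negbTE.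
by apply: eq_card => e; rewrite !inE subsetI; case: (v \in _).
Qed.

Section LightPoint.
Variable x : V -> R.
Hypothesis x_ge0 : forall v, 0 <= x v.
Hypothesis x_lt_half : forall v, x v < 2^-1.
Hypothesis slack_ge0 : forall S, (1 < #|S|)%N -> 0 <= slack x S.

Lemma edge_weight_gt0 e : 0 < edge_weight x e.
Proof.
rewrite edge_weightE.
have /cards2P[a [b [ab ->]]] := introT eqP (card_ends e).
rewrite big_setU1 ?inE //= big_set1.
have := x_lt_half a; have := x_lt_half b; lra.
Qed.

(** With inner degree at least 2, the term of [v] in [slackE] is at most
    [1 - x v - 2 * (2^-1 - x v) = x v]. *)
Lemma core_sum_ge1 S : (1 < #|S|)%N -> (forall v, v \in S -> (1 < deg S v)%N) ->
  1 <= \sum_(v in S) x v.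
Proof.
move=> /slack_ge0; rewrite slackE => S0 dS.
suff : \sum_(v in S) (1 - x v - (deg S v)%:R * (2^-1 - x v))
       <= \sum_(v in S) x v by lra.
apply: ler_sum => v /dS; rewrite -(ler_nat R) => d2.
have := x_lt_half v; have := x_ge0 v; nra.
Qed.

Lemma inner_edge_card S e : ends e \subset S -> (1 < #|S|)%N.
Proof. by move/subset_leq_card; rewrite card_ends. Qed.

Definition tight S := (1 < #|S|)%N && (slack x S == 0).

Lemma tight_has_edge S : tight S -> exists e, ends e \subset S.
Proof.
case/andP => S1 /eqP S0; apply/existsP; apply: contraT; rewrite negb_exists.
move=> /forallP noe; move: S0; rewrite /slack [X in _ - X - _]big_pred0; last first.
  by move=> e; apply: negbTE; exact: noe.
have : \sum_(v in S) (2^-1 : R) < \sum_(v in S) (1 - x v).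
  have [v0 v0S] : exists v, v \in S by apply/set0Pn; rewrite -card_gt0 ltnW.
  apply: ltr_sum => [|v _]; last by have := x_lt_half v; lra.
  by apply/hasP; exists v0; rewrite ?mem_index_enum.
rewrite sumr_const -[_ *+ _]mulr_natl.
have : (2%:R : R) <= #|S|%:R by rewrite ler_nat.
lra.
Qed.

(** The slacks of union and intersection and the cross weight are nonnegative with sum 0; positivity
    of edge weights then excludes cross edges. *)
Lemma tight_setUI S T : tight S -> tight T -> (1 < #|S :&: T|)%N ->
  [/\ tight (S :|: T), tight (S :&: T) & forall e, ~~ cross S T e].
Proof.
move=> /andP[S1 /eqP S0] /andP[T1 /eqP T0] I1.
have U1 : (1 < #|S :|: T|)%N.
  by apply: leq_trans S1 _; apply/subset_leq_card/subsetUl.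
have := slack_setUI x S T; rewrite S0 T0 /tight I1 U1 /=.
have := slack_ge0 I1; have := slack_ge0 U1.
have sc0 : 0 <= \sum_(e | cross S T e) edge_weight x e.
  by apply: sumr_ge0 => e _; apply/ltW/edge_weight_gt0.
move=> U0 I0 eq0; split; try by apply/eqP; lra.
move=> e; apply/negP => ce.
have /eqP : \sum_(e | cross S T e) edge_weight x e = 0 by lra.
rewrite psumr_eq0 => [/allP/(_ e)|e' _]; last exact/ltW/edge_weight_gt0.
by rewrite mem_index_enum ce gt_eqF ?edge_weight_gt0 // => /(_ isT).
Qed.

Lemma slackD1 S u : u \in S ->
  slack x S = slack x (S :\ u) + (1 - x u)
    - \sum_(e | (u \in ends e) && (ends e \subset S)) edge_weight x e.
Proof.
move=> uS; rewrite /slack (big_setD1 u uS) /=.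
rewrite [\sum_(e | ends e \subset S) _](bigID (fun e => u \in ends e)) /=.
rewrite (eq_bigl (fun e => (u \in ends e) && (ends e \subset S))); last first.
  by move=> e; rewrite andbC.
rewrite [\sum_(e | _ && ~~ _) _](eq_bigl (fun e => ends e \subset S :\ u)).
  move: (\sum_(e | (u \in ends e) && _) _) (\sum_(e | ends e \subset _) _).
  by move: (\sum_(i in _) _) => a b c; ring.
by move=> e; rewrite subsetD1.
Qed.

(** Removing a vertex isolated in [S] would make the slack negative; an inner edge guarantees that
    two vertices remain. *)
Lemma tight_deg_gt0 S v : tight S -> v \in S -> (0 < deg S v)%N.
Proof.
move=> tS vS; have [e eS] := tight_has_edge tS.
rewrite lt0n; apply/negP; rewrite cards_eq0 => /eqP d0.
have noe e' : (v \in ends e') && (ends e' \subset S) = false.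
  by have := in_set0 e'; rewrite -d0 inE.
case/andP: tS => _; rewrite (slackD1 vS) [X in _ - X]big_pred0 // subr0 gt_eqF //.
have eSv : ends e \subset S :\ v.
  by rewrite subsetD1 eS; have := noe e; rewrite eS andbT => ->.
have := slack_ge0 (inner_edge_card eSv); have := x_lt_half v; lra.
Qed.

(** Inner degrees in a tight set are at least 1, so these are exactly the tight sets whose [slope]
    is not identically 0. *)
Definition nontrivial S :=
  tight S && [exists v in S, (x v != 0) && (1 < deg S v)%N].

(** The coefficient of [d v] in [slack_shift], replaced by 0 where [x v = 0], since the directions
    sought vanish there. *)
Definition slope S v : R := if (v \in S) && (x v != 0) then (deg S v)%:R - 1 else 0.

Lemma slope_trivial S v : tight S -> ~~ nontrivial S -> slope S v = 0.
Proof.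
move=> tS; rewrite /nontrivial tS /= /slope => nS.
case: ifP => // /andP[vS xv]; have := tight_deg_gt0 tS vS.
have : ~~ (1 < deg S v)%N.
  apply: contra nS => dv; apply/existsP; exists v; rewrite vS xv; exact: dv.
by case: (deg S v) => [|[|]] // _ _; rewrite subrr.
Qed.

Lemma nontrivialS S T : nontrivial S -> tight T -> S \subset T -> nontrivial T.
Proof.
case/andP => _ /existsP[v /and3P[vS xv dv]] tT sST.
rewrite /nontrivial tT /=; apply/existsP; exists v.
by rewrite (subsetP sST) // xv (leq_trans dv) // degS.
Qed.

(** If [w] is the neighbour of the leaf [u], then [slack x S = slack x (S :\ u) + x w], so both
    summands are 0. Apart from [u], of slope 0, only [w] loses degree, and [slope] ignores it
    because [x w = 0]. *)
Lemma nontrivial_leaf S u : nontrivial S -> u \in S -> (deg S u <= 1)%N ->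
  nontrivial (S :\ u) /\ slope (S :\ u) =1 slope S.
Proof.
case/andP => tS /existsP[v /and3P[vS xv dv]] uS du.
have du1 : deg S u = 1%N by apply/eqP; rewrite eqn_leq du tight_deg_gt0.
(* [v] has more inner edges than [u], so one of them avoids [u]; it ensures that [S :\ u] has two
   vertices. *)
have [e /andP[ve eS] nue] : exists2 e, (v \in ends e) && (ends e \subset S) &
    u \notin ends e.
  have : ~~ ([set e | (v \in ends e) && (ends e \subset S)]
              \subset [set e | (u \in ends e) && (ends e \subset S)]).
    by apply/negP => /subset_leq_card; rewrite -/(deg S v) -/(deg S u) leqNgt
         (leq_ltn_trans du dv).
  case/subsetPn => e; rewrite !inE => h nh; exists e => //.
  by move: nh; case/andP: h => _ ->; rewrite andbT.
have eSu : ends e \subset S :\ u by rewrite subsetD1 eS.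
have S'1 := inner_edge_card eSu.
have /cards1P[e0 Ee0] : #|[set e | (u \in ends e) && (ends e \subset S)]| == 1%N.
  exact/eqP.
have ee0 e' : (u \in ends e') && (ends e' \subset S) = (e' == e0).
  by have := in_set1 e' e0; rewrite -Ee0 inE.
have ue0 : u \in ends e0 by have := ee0 e0; rewrite eqxx => /andP[].
have [slack0 x0] : slack x (S :\ u) = 0 /\ \sum_(w in ends e0 :\ u) x w = 0.
  have /andP[_ /eqP] := tS; rewrite (slackD1 uS) (eq_bigl _ _ ee0) big_pred1_eq.
  rewrite /edge_weight (big_setD1 u ue0) /=.
  have := slack_ge0 S'1.
  have : 0 <= \sum_(w in ends e0 :\ u) x w by apply: sumr_ge0.
  by split; lra.
have xe0 w : w \in ends e0 :\ u -> x w = 0.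
  by move=> we; apply: (psumr_eq0P _ x0).
have tS' : tight (S :\ u) by rewrite /tight S'1 slack0 eqxx.
have degE w : w \in S :\ u -> x w != 0 -> deg (S :\ u) w = deg S w.
  move=> wS xw; apply: eq_card => e'; rewrite !inE subsetD1.
  have [we|//] := boolP (w \in ends e'); have [eS'|//] := boolP (ends e' \subset S).
  rewrite /=; apply/negP => ue; have := ee0 e'; rewrite ue eS' => /esym/eqP Ee.
  move: xw; rewrite xe0 ?eqxx // -Ee; move: wS; rewrite !inE we.
  by case/andP => ->.
split.
  rewrite /nontrivial tS' /=; apply/existsP; exists v.
  have vu : v != u by apply: contraTneq dv => ->; rewrite -leqNgt.
  have vS' : v \in S :\ u by rewrite !inE vu.
  by rewrite vS' xv degE.
move=> w; rewrite /slope; have [->|wu] := eqVneq w u.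
  by rewrite !inE eqxx uS du1 subrr; case: ifP.
have -> : (w \in S :\ u) = (w \in S) by rewrite !inE wu.
by case: ifP => // /andP[wS xw]; rewrite degE // !inE wu.
Qed.

Lemma nontrivial_setUI S T : nontrivial S -> nontrivial T ->
  (1 < #|S :&: T|)%N ->
  [/\ nontrivial (S :|: T), tight (S :&: T) &
      forall v, slope S v + slope T v = slope (S :|: T) v + slope (S :&: T) v].
Proof.
move=> nS nT I1; have /andP[tS _] := nS; have /andP[tT _] := nT.
have [tU tI nc] := tight_setUI tS tT I1.
split=> //; first exact: nontrivialS nS tU (subsetUl _ _).
move=> v; rewrite /slope !inE.
have := deg_setUI v nc.
have d0 (P : {set V}) : v \notin P -> deg P v = 0%N.
  move=> nP; apply/eqP; rewrite cards_eq0; apply/eqP/setP => e; rewrite !inE.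
  by apply/negP => /andP[ve /subsetP/(_ v ve)]; apply/negP.
move/(congr1 (fun n => n%:R : R)); rewrite !natrD.
have [vS|nvS] := boolP (v \in S); have [vT|nvT] := boolP (v \in T) => /=;
  case: (x v != 0) => /=; rewrite ?addr0 //; try lra.
- by rewrite (d0 T) // (d0 (S :&: T)) ?inE ?vS // !addr0 => ->.
- by rewrite (d0 S) // (d0 (S :&: T)) ?inE ?(negbTE nvS) // !addr0 !add0r => ->.
Qed.

(** * Counting nonzero coordinates in tight sets *)

Definition frac S := #|[set v in S | x v != 0]|.

(** Coordinates are below 1/2, so two of them cannot sum to 1. *)
Lemma frac_ge3 S : 1 <= \sum_(v in S) x v -> (2 < frac S)%N.
Proof.
move=> S1; rewrite ltnNge; apply/negP => le2.
have : \sum_(v in S) x v = \sum_(v in [set v in S | x v != 0]) x v.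
  rewrite [LHS](bigID (fun v => x v != 0)) /= [X in _ + X]big1 ?addr0.
    by apply: eq_bigl => v; rewrite inE.
  by move=> v /andP[_ /negPn/eqP].
have : (#|[set v in S | x v != 0]|%:R <= 2%:R :> R) by rewrite ler_nat.
have : \sum_(v in [set v in S | x v != 0]) x v
     <= \sum_(v in [set v in S | x v != 0]) 2^-1.
  by apply: ler_sum => v _; exact: ltW.
have [->|[v0 v0S]] := set_0Vmem [set v in S | x v != 0].
  rewrite !big_set0; lra.
have : \sum_(v in [set v in S | x v != 0]) x v
     < \sum_(v in [set v in S | x v != 0]) 2^-1.
  apply: ltr_sum => //; apply/hasP; exists v0; rewrite ?mem_index_enum //.
rewrite sumr_const -[_ *+ _]mulr_natl; lra.
Qed.

Lemma fracS S T : S \subset T -> (frac S <= frac T)%N.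
Proof.
move=> sST; apply/subset_leq_card/subsetP => v; rewrite !inE => /andP[vS ->].
by rewrite (subsetP sST).
Qed.

(** No edge lies inside two members, so comparing their zero slacks with the nonnegative slack of
    the union bounds the sum of [(1 - x v) * (k v - 1)] by [#|F| - 1], where [k v] counts the
    members through [v]. As [1 - x v > 1/2], the overlap [K] on nonzero coordinates is either 0 or
    strictly below [2 * (#|F| - 1)]; strictness yields the term [(1 < #|F|)]. *)
Lemma linear_family_count (F : {set {set V}}) :
  (forall M, M \in F -> tight M) ->
  {in F &, forall M N, M != N -> (#|M :&: N| <= 1)%N} -> F != set0 ->
  (\sum_(M in F) frac M + 2 + (1 < #|F|) <= frac (cover F) + 2 * #|F|)%N.
Proof.
move=> tF linF /set0Pn[M0 M0F]; set U := cover F.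
have subU M : M \in F -> M \subset U by move=> MF; apply: (bigcup_max M).
have U1 : (1 < #|U|)%N.
  have /andP[M1 _] := tF _ M0F; exact: leq_trans M1 (subset_leq_card (subU _ M0F)).
pose k v := #|[set M in F | v \in M]|.
have k_gt0 v : v \in U -> (0 < k v)%N.
  by case/bigcupP => M MF vM; apply/card_gt0P; exists M; rewrite inE MF.
have edges : \sum_(M in F) \sum_(e | ends e \subset M) edge_weight x e
    <= \sum_(e | ends e \subset U) edge_weight x e.
  rewrite (exchange_big_dep (fun e => ends e \subset U)) /=; last first.
    by move=> M e MF; move/subset_trans; apply; exact: subU.
  apply: ler_sum => e eU; rewrite sumr_const -mulr_natr.
  rewrite ler_piMr ?(ltW (edge_weight_gt0 _)) // lern1.
  apply/card_le1_eqP => M N /andP[MF eM] /andP[NF eN].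
  apply/eqP; apply: contraT => MN; have := linF _ _ NF MF MN; rewrite leqNgt.
  by rewrite -(card_ends e) subset_leq_card // subsetI eM andbT.
have slackU := slack_ge0 U1.
have : \sum_(M in F) slack x M = 0.
  by apply: big1 => M /tF/andP[_ /eqP].
rewrite /slack !sumrB sumr_const => slackF.
have cardk v (P : pred V) : P v ->
    #|[pred M | (M \in F) && ((v \in M) && P v)]| = k v.
  by move=> Pv; rewrite /k cardsE; apply: eq_card => M; rewrite !unfold_in /= Pv andbT.
have vert : \sum_(M in F) \sum_(v in M) (1 - x v) = \sum_(v in U) (1 - x v) *+ k v.
  rewrite (exchange_big_dep (mem U)) /=; last first.
    by move=> M v MF vM; rewrite (subsetP (subU _ MF)).
  apply: eq_bigr => v vU; rewrite sumr_const; congr (_ *+ _).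
  by rewrite /k cardsE; apply: eq_card => M; rewrite !unfold_in.
have excess : \sum_(v in U) (1 - x v) * (k v - 1)%:R <= #|F|%:R - 1.
  have -> : \sum_(v in U) (1 - x v) * (k v - 1)%:R
      = \sum_(v in U) (1 - x v) *+ k v - \sum_(v in U) (1 - x v).
    rewrite -sumrB; apply: eq_bigr => v /k_gt0 kv.
    by rewrite natrB // mulrBr mulr1 mulr_natr.
  move: slackU; rewrite /slack; move: slackF vert edges; rewrite /slack; lra.
have fracF : (\sum_(M in F) frac M = \sum_(v in U | x v != 0%R) k v)%N.
  rewrite /frac; under eq_bigr => M _ do rewrite -sum1dep_card.
  rewrite (exchange_big_dep (fun v => (v \in U) && (x v != 0%R))) /=; last first.
    by move=> M v MF /andP[vM ->]; rewrite (subsetP (subU _ MF)).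
  apply: eq_bigr => v /andP[vU xv]; rewrite sum_nat_const muln1.
  exact: (cardk v (fun v => x v != 0%R)).
have fracU : (\sum_(M in F) frac M
    = \sum_(v in U | x v != 0%R) (k v - 1) + frac U)%N.
  rewrite fracF /frac -sum1dep_card -big_split /=; apply: eq_bigr => v.
  by case/andP => /k_gt0 kv _; rewrite subnK.
set K := (\sum_(v in U | x v != 0%R) (k v - 1))%N in fracU.
have FK0 : (0 < #|F|)%N by apply/card_gt0P; exists M0.
suff : (0 < K)%N -> (K.+1 <= 2 * (#|F| - 1))%N.
  by rewrite fracU; case: (posnP K) => [-> _|K0 /(_ isT)]; lia.
rewrite lt0n sum_nat_eq0 negb_forall => /existsP[v0].
rewrite negb_imply => /andP[/andP[v0U xv0] kv0].
rewrite -(ltr_nat R) natrM natrB // natr_sum.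
have half v : v \in U -> 0 <= ((k v - 1)%:R : R) * (2^-1 - x v).
  by move=> _; apply: mulr_ge0 => //; rewrite subr_ge0 ltW.
have : \sum_(v in U | x v != 0) ((k v - 1)%:R : R)
     < \sum_(v in U | x v != 0) 2 * ((1 - x v) * (k v - 1)%:R).
  rewrite (bigD1 v0) ?v0U //= [X in _ < X](bigD1 v0) ?v0U //=.
  apply: ltr_leD.
    have : (0 < (k v0 - 1)%:R :> R) by rewrite ltr0n lt0n.
    have := x_lt_half v0; nra.
  apply: ler_sum => v _; have : (0 <= (k v - 1)%:R :> R) by [].
  have := x_lt_half v; nra.
move/lt_le_trans; apply.
rewrite -mulr_sumr ler_pM2l // (le_trans _ excess) //.
rewrite [X in _ <= X](bigID (fun v => x v != 0)) /= lerDl sumr_ge0 // => v _.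
by apply: mulr_ge0 => //; have := x_lt_half v; lra.
Qed.

(** * Rank of the slope vectors of tight sets *)

Definition slope_vec S : 'rV[R]_#|V| := \row_i slope S (enum_val i).

Definition slope_space S : 'M[R]_#|V| :=
  (\sum_(T : {set V} | tight T && (T \subset S)) <<slope_vec T>>)%MS.

Lemma slope_vec_sub S T : tight T -> T \subset S ->
  (slope_vec T <= slope_space S)%MS.
Proof.
by move=> tT sTS; apply: (sumsmx_sup T); rewrite ?tT // genmxE.
Qed.

Lemma slope_space_sub m (A : 'M_(m, #|V|)) S :
  (forall T, nontrivial T -> T \subset S -> (slope_vec T <= A)%MS) ->
  (slope_space S <= A)%MS.
Proof.
move=> sub; apply/sumsmx_subP => T /andP[tT sTS]; rewrite genmxE.
have [nT|nT] := boolP (nontrivial T); first exact: sub.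
suff -> : slope_vec T = 0 by exact: sub0mx.
by apply/rowP => i; rewrite !mxE slope_trivial.
Qed.

Lemma slope_vec_setUI S T : nontrivial S -> nontrivial T ->
  (1 < #|S :&: T|)%N ->
  slope_vec T = slope_vec (S :|: T) + slope_vec (S :&: T) - slope_vec S.
Proof.
move=> nS nT /(nontrivial_setUI nS nT)[_ _ eqs].
by apply/rowP => i; rewrite !mxE -eqs addrC addKr.
Qed.

Lemma rank_sumsmx (I : finType) (P : pred I) (B : I -> 'M[R]_#|V|) :
  (\rank (\sum_(i | P i) B i)%MS <= \sum_(i | P i) \rank (B i))%N.
Proof.
elim/big_rec2: _ => [|i n A _ le_n]; first by rewrite mxrank0.
by apply: leq_trans (mxrank_adds_leqif _ _) _; rewrite leq_add2l.
Qed.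

Lemma rank_sum_families (F : {set {set V}}) :
  (forall M, M \in F -> (\rank (slope_space M) + 2 <= frac M)%N) ->
  (\rank (\sum_(M in F) slope_space M)%MS + 2 * #|F| <= \sum_(M in F) frac M)%N.
Proof.
move=> leF; apply: (@leq_trans (\sum_(M in F) (\rank (slope_space M) + 2))).
  by rewrite big_split /= sum_nat_const mulnC leq_add2r rank_sumsmx.
exact: leq_sum.
Qed.

Lemma nontrivial_tight S : nontrivial S -> tight S.
Proof. by case/andP. Qed.

(** Two maximal members meeting in two vertices would both equal their union. *)
Lemma max_families_linear (P : pred {set V}) :
  (forall S, P S -> nontrivial S) ->
  (forall S T, P S -> P T -> (1 < #|S :&: T|)%N -> P (S :|: T)) ->
  {in [set M | maxset P M] &, forall M N, M != N -> (#|M :&: N| <= 1)%N}.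
Proof.
move=> ntP PU M N; rewrite !inE => /maxsetP[PM maxM] /maxsetP[PN maxN].
apply: contraNT; rewrite -ltnNge => /(PU _ _ PM PN) PMN; apply/eqP.
by rewrite -(maxM _ PMN (subsetUl _ _)) (maxN _ PMN (subsetUr _ _)).
Qed.

(** Equal counts make [x] vanish on [T :\: S]. Removing a vertex there of degree at most 1 in [T]
    leaves [S] and changes no slope. If there is none, tightness of both sets excludes edges between
    [S] and [T :\: S], and [core_sum_ge1] applied to [T :\: S] contradicts its zero coordinates. *)
Lemma slope_vec_supset S T : nontrivial T -> S \proper T ->
  (forall N, nontrivial N -> S \subset N -> N \proper T -> N = S) ->
  nontrivial S ->
  frac S = frac T -> slope_vec T = slope_vec S.
Proof.
move=> nT /andP[sST nTS] minT nS eq_frac.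
have x0 v : v \in T :\: S -> x v = 0.
  rewrite inE => /andP[nvS vT]; apply/eqP; apply: contraT => xv.
  suff : (frac S < frac T)%N by rewrite eq_frac ltnn.
  apply: proper_card; apply/properP; split.
    by apply/subsetP => w; rewrite !inE => /andP[wS ->]; rewrite (subsetP sST).
  by exists v; rewrite !inE ?vT ?xv // (negbTE nvS).
have [z /andP[zZ dz']|nlow] := @pickP _ [pred z in T :\: S | (deg T z <= 1)%N].
  have /setDP[zT zS] := zZ.
  have [nT' eqs] := nontrivial_leaf nT zT dz'.
  have <- : T :\ z = S.
    apply: minT => //; first by rewrite subsetD1 sST.
    by apply/properP; split; [exact: subsetDl | exists z; rewrite ?inE ?eqxx].
  by apply/rowP => i; rewrite !mxE eqs.
have degZ z : z \in T :\: S -> (1 < deg T z)%N.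
  by move=> zZ; have := nlow z; rewrite inE zZ /= ltnNge => ->.
have /andP[_ /eqP] := nontrivial_tight nT; have /andP[_ /eqP] := nontrivial_tight nS.
rewrite !slackE => S0 T0.

(* [dd v] is the drop in the term of [v] in [slackE] from [S] to [T]. The terms on [T :\: S] are at
   most 0, so tightness of both sets makes every drop 0. *)
pose dd v := ((deg T v)%:R - (deg S v)%:R) * (2^-1 - x v).
have dd_ge0 v : 0 <= dd v.
  by rewrite mulr_ge0 // subr_ge0 ?ler_nat ?degS // ltW.
have dd0 : \sum_(v in S) dd v = 0.
  apply/eqP; rewrite eq_le sumr_ge0 // andbT.
  have : \sum_(v in T :\: S) (1 - x v - (deg T v)%:R * (2^-1 - x v)) <= 0.
    apply: sumr_le0 => v vZ; rewrite (x0 _ vZ).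
    have : (2%:R : R) <= (deg T v)%:R by rewrite ler_nat degZ.
    lra.
  move: T0; rewrite (big_setID S) /= (setIidPr sST).
  have -> : \sum_(v in S) (1 - x v - (deg T v)%:R * (2^-1 - x v))
    = \sum_(v in S) (1 - x v - (deg S v)%:R * (2^-1 - x v)) - \sum_(v in S) dd v.
    by rewrite -sumrB; apply: eq_bigr => v _; rewrite /dd; ring.
  lra.
have degE v : v \in S -> deg T v = deg S v.
  move=> vS; have /eqP := psumr_eq0P (fun v _ => dd_ge0 v) dd0 vS.
  rewrite mulf_eq0 !subr_eq0 [_ == x v]gt_eqF // orbF eqr_nat.
  by move/eqP.
have inner e : ends e \subset T -> ~~ (ends e \subset S) -> ends e \subset T :\: S.
  move=> eT eS; rewrite subsetD eT /= -setI_eq0; apply: contraNT eS.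
  case/set0Pn => v; rewrite inE => /andP[ve vS].
  have sub : [set e | (v \in ends e) && (ends e \subset S)]
      \subset [set e | (v \in ends e) && (ends e \subset T)].
    by apply/subsetP => e'; rewrite !inE => /andP[->] /subset_trans; apply.
  have /eqP Eset : [set e | (v \in ends e) && (ends e \subset S)]
      == [set e | (v \in ends e) && (ends e \subset T)].
    by rewrite eqEcard sub /=; have := degE v vS; rewrite /deg => ->.
  have : e \in [set e | (v \in ends e) && (ends e \subset T)] by rewrite inE ve.
  by rewrite -Eset inE => /andP[].
have degZZ z : z \in T :\: S -> (1 < deg (T :\: S) z)%N.
  move=> zZ; apply: leq_trans (degZ z zZ) _.
  apply/subset_leq_card/subsetP => e; rewrite !inE => /andP[ze eT].
  rewrite ze; apply: inner => //; apply/negP => /subsetP/(_ z ze).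
  by move: zZ; rewrite inE => /andP[/negbTE ->].
have [z zZ] : exists z, z \in T :\: S by apply/set0Pn; rewrite setD_eq0.
have [e] : exists e, e \in [set e | (z \in ends e) && (ends e \subset T :\: S)].
  by apply/card_gt0P; exact: ltnW (degZZ z zZ).
rewrite inE => /andP[_ /inner_edge_card Z1].
have := core_sum_ge1 Z1 degZZ.
by rewrite big1 // ler10.
Qed.

(* For a maximal nontrivial tight proper subset [C] of [D], a tight subset of [D]
   either meets [C] in two vertices, and then uncrosses with [C] to [C] or [D], or
   lies in one of the maximal sets [F] meeting [C] in at most one vertex. *)
Lemma rank_slope_space S : nontrivial S -> (\rank (slope_space S) + 2 <= frac S)%N.
Proof.
have [n] := ubnP #|S|; elim: n S => // n IH D /ltnSE leD nD.
have tD := nontrivial_tight nD.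
have slope_rank : (\rank (slope_vec D) <= 1)%N by exact: rank_leq_row.
(* Base case, without [C0]: the space is spanned by one vector, and [D] has no vertex of degree at
   most 1, since its removal would give a smaller nontrivial set; hence [frac D >= 3]. *)
have [C0 /andP[nC0 C0D]|noC] := @pickP _ [pred C | nontrivial C && (C \proper D)];
  last first.
  have subD : (slope_space D <= slope_vec D)%MS.
    apply: slope_space_sub => T nT sTD; have := noC T; rewrite /= nT /=.
    by rewrite properEneq sTD andbT => /negbFE/eqP ->.
  have := mxrankS subD; suff : (2 < frac D)%N by lia.
  apply: frac_ge3; apply: core_sum_ge1; first by case/andP: tD.
  move=> v vD; rewrite ltnNge; apply/negP => /(nontrivial_leaf nD vD)[nDv _].
  have := noC (D :\ v); rewrite /= nDv /= => /negP; apply.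
  by apply/properP; split; [exact: subsetDl | exists v; rewrite ?inE ?eqxx].
have [|C /maxsetP[/andP[nC CD] maxC] _] :=
    @maxset_exists _ [pred C | nontrivial C && (C \proper D)] C0.
  by rewrite /= nC0.
have tC := nontrivial_tight nC; have /andP[C1 _] := tC.
have rC := IH C (leq_trans (proper_card CD) leD) nC.
have above_C N : nontrivial N -> C \subset N -> N \subset D -> N = C \/ N = D.
  move=> nN CN ND; have [->|neq] := eqVneq N D; first by right.
  by left; apply: maxC; rewrite //= nN properEneq neq.
pose P := [pred T : {set V} | [&& nontrivial T, T \subset D & (#|T :&: C| <= 1)%N]].
pose F := [set M | maxset P M].
have FP M : M \in F -> P M by rewrite inE => /maxsetp.
have linF : {in F &, forall M N, M != N -> (#|M :&: N| <= 1)%N}.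
  apply: max_families_linear => [S /and3P[]//|S T].
  move=> /and3P[nS SD SC] /and3P[nT TD TC] I1.
  have [nU _ _] := nontrivial_setUI nS nT I1.
  rewrite /= nU subUset SD TD /= leqNgt; apply/negP => UC1.
  (* This intersection contains an edge. The edge is not a cross edge, so it lies in [S] or in [T],
     which then already meets [C] in two vertices. *)
  have [_ tI _] := nontrivial_setUI nU nC UC1.
  have [e] := tight_has_edge tI; rewrite subsetI => /andP[eU eC].
  have [_ _ /(_ e)] := tight_setUI (nontrivial_tight nS) (nontrivial_tight nT) I1.
  rewrite /cross eU /= -negb_or => /negP; apply; apply/norP; split.
    by apply: contraL SC => eS; rewrite -ltnNge; apply: (@inner_edge_card _ e); rewrite subsetI eS.
  by apply: contraL TC => eT; rewrite -ltnNge; apply: (@inner_edge_card _ e); rewrite subsetI eT.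
have CF : C \notin F by apply/negP => /FP /and3P[_ _]; rewrite setIid leqNgt C1.
have FD M : M \in F -> (#|M| < n)%N.
  case/FP/and3P => _ MD MC; apply: leq_trans leD; apply: proper_card.
  rewrite properEneq MD andbT; apply: contraL MC => /eqP ->.
  by rewrite (setIidPr (proper_sub CD)) -ltnNge.
have rF : (\rank (\sum_(M in F) slope_space M)%MS + 2 * #|F| <= \sum_(M in F) frac M)%N.
  apply: rank_sum_families => M MF; have /and3P[nM _ _] := FP M MF.
  exact: IH (FD M MF) nM.
(* The count for [C] together with [F]; for nonempty [F] its extra 1 pays for the vector of [D]. *)
have countF : (frac C + \sum_(M in F) frac M + 2 + (0 < #|F|)
               <= frac D + 2 * (#|F|.+1))%N.
  have := @linear_family_count (C |: F); rewrite big_setU1 //= cardsU1 CF add1n ltnS.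
  have sub : cover (C |: F) \subset D.
    apply/bigcupsP => M; rewrite in_setU1 => /predU1P[->|/FP/and3P[]//].
    exact: proper_sub.
  move=> H; apply: leq_trans (leq_add (fracS sub) (leqnn _)); apply: H.
  - by move=> M /setU1P[->//|/FP/and3P[/nontrivial_tight]].
  - move=> M N /setU1P[->|MF] /setU1P[->|NF]; rewrite ?eqxx //; last exact: linF.
      by rewrite setIC; have /and3P[] := FP N NF.
    by have /and3P[] := FP M MF.
  - by apply/set0Pn; exists C; rewrite setU11.
have subD : (slope_space D
    <= slope_space C + slope_vec D + \sum_(M in F) slope_space M)%MS.
  apply: slope_space_sub => T nT TD.
  have [TC|TC] := leqP #|T :&: C| 1.
    have [M maxM TM] := @maxset_exists _ P T (introT and3P (And3 nT TD TC)).
    apply: submx_trans (addsmxSr _ _); apply: (sumsmx_sup M); first by rewrite inE.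
    exact: slope_vec_sub (nontrivial_tight nT) TM.
  apply: submx_trans (addsmxSl _ _); rewrite setIC in TC.
  rewrite (slope_vec_setUI nC nT TC).
  have [nU tI _] := nontrivial_setUI nC nT TC.
  have subC := addsmxSl (slope_space C) (slope_vec D).
  apply: addmx_sub; last first.
    by rewrite eqmx_opp; apply: submx_trans subC; apply: slope_vec_sub.
  apply: addmx_sub; last first.
    by apply: submx_trans subC; apply: slope_vec_sub (subsetIl _ _).
  have UD : C :|: T \subset D by rewrite subUset TD proper_sub.
  have [->|->] := above_C (C :|: T) nU (subsetUl _ _) UD.
  - by apply: submx_trans subC; apply: slope_vec_sub.
  - exact: addsmxSr.
have rank_le : (\rank (slope_space D) <= \rank (slope_space C + slope_vec D)%MS
    + \rank (\sum_(M in F) slope_space M)%MS)%N.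
  by apply: leq_trans (mxrankS subD) _; exact: mxrank_adds_leqif.
have rankCD : (\rank (slope_space C + slope_vec D)%MS
    <= \rank (slope_space C) + \rank (slope_vec D))%N.
  exact: mxrank_adds_leqif.
have [F0|Fpos] := posnP #|F|; last by move: countF; rewrite Fpos; lia.
have fracCD := fracS (proper_sub CD).
move: rF; move/eqP: F0; rewrite cards_eq0 => /eqP F0; move: rank_le.
rewrite F0 !big_set0 mxrank0 addn0 => rank_le _.
(* For empty [F], the vector of [D] is paid for by a nonzero coordinate outside [C], or else
   coincides with the vector of [C]. *)
have [eqf|neqf] := eqVneq (frac C) (frac D); last by lia.
have vecE : slope_vec D = slope_vec C.
  apply: slope_vec_supset => // N nN CN ND.
  have [//|ED] := above_C N nN CN (proper_sub ND).
  by move: ND; rewrite ED properxx.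
move: rank_le; rewrite vecE (addsmx_idPl (slope_vec_sub tC (subxx C))).
lia.
Qed.

(** The tight constraints and the equations [d v = 0] at zero coordinates have total rank below
    [#|V|], by the count on maximal nontrivial sets; [d] is orthogonal to them all. If there are no
    nontrivial sets, [S] supplies the nonzero coordinates that leave room for [d]. *)
Lemma light_point_direction (S : {set V}) :
  (1 < #|S|)%N -> (forall v, v \in S -> (1 < deg S v)%N) ->
  exists d : V -> R, [/\ exists v, d v != 0, forall v, x v = 0 -> d v = 0 &
    forall T, tight T -> \sum_(v in T) ((deg T v)%:R - 1) * d v = 0].
Proof.
move=> S1 dS.
have fS : (2 < frac S)%N by apply: frac_ge3; exact: core_sum_ge1.
have fV := fracS (subsetT S).
pose F := [set M | maxset nontrivial M].
have FP M : M \in F -> nontrivial M by rewrite inE => /maxsetp.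
have rank_lt : (\rank (slope_space setT) < frac setT)%N.
  have subF : (slope_space setT <= \sum_(M in F) slope_space M)%MS.
    apply: slope_space_sub => T nT _.
    have [M maxM TM] := maxset_exists nT.
    apply: (sumsmx_sup M); first by rewrite inE.
    exact: slope_vec_sub (nontrivial_tight nT) TM.
  have rF : (\rank (\sum_(M in F) slope_space M)%MS + 2 * #|F|
             <= \sum_(M in F) frac M)%N.
    by apply: rank_sum_families => M /FP; exact: rank_slope_space.
  have := mxrankS subF.
  have [->|F0] := eqVneq F set0.
    by rewrite !big_set0 mxrank0; lia.
  have count : (\sum_(M in F) frac M + 2 + (1 < #|F|)
                <= frac (cover F) + 2 * #|F|)%N.
    apply: linear_family_count => // [M /FP|]; first exact: nontrivial_tight.
    apply: max_families_linear => // S' T' nS' nT' I1.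
    by have [] := nontrivial_setUI nS' nT' I1.
  have := fracS (subsetT (cover F)); lia.
pose zero_rows : 'M[R]_#|V| :=
  (\sum_(v in [set v | x v == 0%R]) <<delta_mx (0 : 'I_1) (enum_rank v)>>)%MS.
pose B := (slope_space setT + zero_rows)%MS.
have rankB : (\rank B < #|V|)%N.
  apply: leq_ltn_trans (mxrank_adds_leqif _ _) _.
  have : (\rank zero_rows <= #|[set v | x v == 0%R]|)%N.
    apply: leq_trans (rank_sumsmx _ _) _; rewrite -[leqRHS]sum1_card.
    by apply: leq_sum => v _; rewrite mxrank_gen; exact: rank_leq_row.
  suff : (frac setT + #|[set v | x v == 0%R]| = #|V|)%N by lia.
  rewrite addnC /frac -(cardsC [set v | x v == 0%R]); congr (_ + _)%N.
  by apply: eq_card => v; rewrite !inE.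
have : kermx B^T != 0.
  rewrite kermx_eq0 /row_free mxrank_tr; apply/eqP => eqV.
  by move: rankB; rewrite eqV ltnn.
case/rowV0Pn => u /sub_kermxP uB unz.
have orth (w : 'rV[R]_#|V|) : (w <= B)%MS -> \sum_i w 0 i * u 0 i = 0.
  case/submxP => X ->.
  have : X *m B *m u^T = 0.
    by rewrite -mulmxA -[B *m _]trmxK trmx_mul trmxK uB trmx0 mulmx0.
  move/matrixP/(_ 0 0); rewrite mxE [RHS]mxE => eq0; rewrite -[RHS]eq0.
  by apply: eq_bigr => i _; rewrite [u^T _ _]mxE.
exists (fun v => u 0 (enum_rank v)).
have d0 v : x v = 0 -> u 0 (enum_rank v) = 0.
  move=> xv; have := orth (delta_mx 0 (enum_rank v)).
  rewrite (bigD1 (enum_rank v)) //= big1 ?addr0; last first.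
    by move=> i iv; rewrite mxE (negbTE iv) andbF mul0r.
  rewrite mxE !eqxx mul1r; apply.
  apply: submx_trans (addsmxSr _ _); apply: (sumsmx_sup v); last by rewrite genmxE.
  by rewrite inE xv.
split=> //.
  have [i ui] : exists i, u 0 i != 0.
    by apply/existsP; apply: contraNT unz; rewrite negb_exists => /forallP u0;
      apply/eqP/rowP => i; rewrite mxE; have := u0 i; rewrite negbK => /eqP.
  by exists (enum_val i); rewrite enum_valK.
move=> T tT.
have := orth (slope_vec T) (submx_trans (slope_vec_sub tT (subsetT T)) (addsmxSl _ _)).
rewrite (reindex_onto (@enum_rank V) enum_val) /=; last by move=> i _; exact: enum_valK.
move=> eq0; rewrite -[RHS]eq0 [LHS]big_mkcond /=.
apply: eq_big => [v|v _]; first by rewrite enum_rankK eqxx.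
rewrite mxE enum_rankK /slope; case: (v \in T); rewrite ?mul0r //=.
by have [/d0 ->|//] := eqVneq (x v) 0; rewrite !mulr0.
Qed.

End LightPoint.
End Slack.

(** * The polyhedron Q'_orient *)

Section Graph.
Variable G : sgraph.

Lemma edge_ends (e : edge G) : exists a b, [/\ adj a b, a != b & val e = [set a; b]].
Proof.
have /imsetP[[a b] /= ab ->] := valP e; exists a, b.
rewrite inE /= in ab; split=> //; apply: contraTneq ab => ->.
by rewrite adj_irrefl.
Qed.

Lemma card_edge (e : edge G) : #|val e| = 2%N.
Proof. by have [a [b [_ ab ->]]] := edge_ends e; rewrite cards2 ab. Qed.

Lemma edge_of_adj (v w : G) : adj v w -> exists e : edge G, val e = [set v; w].
Proof.
move=> vw; have in_E : [set v; w] \in edge_set G.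
  by apply/imsetP; exists (v, w); rewrite ?inE.
by exists (exist (fun e : {set G} => e \in edge_set G) _ in_E).
Qed.

(** The two neighbours on the cycle differ because its length is at least 3. *)
Lemma cycle_deg (s : seq G) : (2 < size s)%N -> ucycle (@adj G) s ->
  forall v, v \in [set w in s] -> (1 < deg (fun e : edge G => val e) [set w in s] v)%N.
Proof.
move=> s2 /andP[cyc us] v; rewrite inE => vs.
have np : next s v != prev s v.
  apply/eqP => /(congr1 (next s)); rewrite next_prev //.
  have [i p Ep] := rot_to vs; rewrite -!(next_rot i us) Ep.
  have : uniq (v :: p) by rewrite -Ep rot_uniq.
  have : (2 < size (v :: p))%N by rewrite -Ep size_rot.
  case: p {Ep} => [|a [|b p]] //= _; rewrite eqxx !inE !negb_or.
  case/andP => /and3P[va vb _] _; rewrite [a == v]eq_sym (negbTE va) eqxx => bv.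
  by rewrite bv eqxx in vb.
have [e1 E1] := edge_of_adj (next_cycle cyc vs).
have [e2 E2] : exists e : edge G, val e = [set v; prev s v].
  by apply: edge_of_adj; rewrite adj_sym prev_cycle.
have e12 : e1 != e2.
  apply: contra np => /eqP e12; have : next s v \in val e2 by rewrite -e12 E1 !inE eqxx orbT.
  rewrite E2 !inE => /orP[/eqP nv|//].
  by have := next_cycle cyc vs; rewrite nv adj_irrefl.
have -> : 2%N = #|[set e1; e2]| by rewrite cards2 e12.
apply/subset_leq_card/subsetP => e; rewrite !inE => /orP[/eqP ->|/eqP ->].
  by rewrite E1 !inE eqxx /= subUset !sub1set !inE vs mem_next.
by rewrite E2 !inE eqxx /= subUset !sub1set !inE vs mem_prev.
Qed.

Lemma flag_sum (R : realType) (P : edge G -> G -> bool) (F : edge G -> G -> R) :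
  \sum_(h : flag G | P (flag_edge h) (flag_vertex h)) F (flag_edge h) (flag_vertex h)
  = \sum_(e : edge G) \sum_(v | (v \in val e) && P e v) F e v.
Proof.
rewrite pair_big_dep /=.
rewrite (reindex_omap (fun h : flag G => val h) insub) /=; last first.
  by move=> [e v] /= /andP[ve _]; rewrite insubT.
by apply: eq_bigl => h; rewrite valK eqxx andbT (valP h).
Qed.

(** * Projecting Q'_orient to the slack inequalities, and lifting back *)

Section Bridge.
Variable R : realType.
Local Notation slackG := (slack (R := R) (fun e : edge G => val e)).
Local Notation weightG := (edge_weight (R := R) (fun e : edge G => val e)).

(** Choose [f] inside [S], if possible. Edge constraints bound from below the [y]-mass of the inner
    edges other than [f], vertex constraints outside [S] that of the edges not inside [S], and the
    total constraint for [f] caps the whole. *)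
Lemma Qorient_slack (p : orient_space R G) : Qorient' R G p ->
  (forall v, p.1 v < 2^-1) ->
  forall S : {set G}, (1 < #|S|)%N -> 0 <= slackG p.1 S.
Proof.
move=> [edgeQ vertexQ totalQ y_ge0 x01] x_lt S S1.
have [f fS|noe] := @pickP _ [pred e : edge G | val e \subset S]; last first.
  rewrite /slack [X in _ - X - _]big_pred0 // subr0 subr_ge0.
  have : \sum_(v in S) (2^-1 : R) <= \sum_(v in S) (1 - p.1 v).
    by apply: ler_sum => v _; have := x_lt v; lra.
  rewrite sumr_const -[_ *+ _]mulr_natl.
  have : (2%:R : R) <= #|S|%:R by rewrite ler_nat.
  lra.
have := totalQ f.
rewrite (bigID (fun h => val (flag_edge h) \subset S)) /= => tot.
have inS : \sum_(e : edge G | (val e \subset S) && (e != f)) weightG p.1 e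
    <= \sum_(h | (flag_edge h != f) && (val (flag_edge h) \subset S)) p.2 (f, h).
  rewrite (partition_big (@flag_edge G) (fun e => (val e \subset S) && (e != f))) /=;
    last by move=> h /andP[-> ->].
  apply: ler_sum => e /andP[eS ef].
  have := edgeQ e f; rewrite /edge_weight.
  rewrite (eq_bigl (fun h => flag_edge h == e)); first by lra.
  by move=> h; case: (eqVneq (flag_edge h) e) => [->|_]; rewrite ?eS ?ef // andbF.
have outS : \sum_(v | v \notin S) (1 - p.1 v)
    <= \sum_(h | (flag_edge h != f) && ~~ (val (flag_edge h) \subset S)) p.2 (f, h).
  have : \sum_(v | v \notin S) (1 - p.1 v) <= \sum_(v | v \notin S)
     \sum_(h | (v \in val (flag_edge h)) && (flag_vertex h != v)) p.2 (f, h).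
    by apply: ler_sum => v _; have := vertexQ v f; lra.
  move/le_trans; apply.
  rewrite (exchange_big_dep (fun h =>
    (flag_edge h != f) && ~~ (val (flag_edge h) \subset S))) /=; last first.
    move=> v h vS /andP[vh _]; apply/andP; split.
      by apply: contraNneq vS => fh; rewrite (subsetP fS) // -fh.
    by apply: contra vS => /subsetP; apply.
  (* A flag [(e, w)] enters only the vertex constraint of the end of [e] other than [w]. *)
  apply: ler_sum => h _; rewrite sumr_const -mulr_natr ler_piMr // lern1.
  apply/card_le1_eqP => v w /andP[_ /andP[vh hv]] /andP[_ /andP[wh hw]].
  have hh : flag_vertex h \in val (flag_edge h) := valP h.
  have [a [b [_ ab Eh]]] := edge_ends (flag_edge h).
  move: (vh : v \in val (flag_edge h)) (wh : w \in val (flag_edge h)) hh hv hw.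
  rewrite Eh !inE.
  by case/orP => /eqP ->; case/orP => /eqP -> //; case/orP => /eqP ->; rewrite eqxx.
have f_in : \sum_(e : edge G | val e \subset S) weightG p.1 e
    = weightG p.1 f + \sum_(e : edge G | (val e \subset S) && (e != f)) weightG p.1 e.
  by rewrite (bigD1 f).
have xf : \sum_v p.1 v = \sum_(v in val f) p.1 v + \sum_(v | v \notin val f) p.1 v.
  by rewrite (bigID (mem (val f))).
have xS : \sum_v (1 - p.1 v) = \sum_(v in S) (1 - p.1 v) + \sum_(v | v \notin S) (1 - p.1 v).
  by rewrite (bigID (mem S)).
have xV : \sum_v (1 - p.1 v) = #|G|%:R - \sum_v p.1 v.
  by rewrite sumrB sumr_const.
rewrite /slack f_in {1}/edge_weight; lra.
Qed.

(** [z e v] is the load that [e] puts on [v]. With capacity 0 at the ends of [f], Hakimi's condition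
    for [S] follows from the slack of [val f :|: S]. Capacity left over is put on one chosen edge at
    each vertex, which turns the load bounds into equalities. *)
Lemma transport (x : G -> R) (f : edge G) :
  no_isolated G -> (forall v, 0 <= x v) -> (forall v, x v < 2^-1) ->
  (forall S : {set G}, (1 < #|S|)%N -> 0 <= slackG x S) ->
  exists z : edge G -> G -> R,
    [/\ forall e v, 0 <= z e v,
        forall e, e != f -> weightG x e <= \sum_(v in val e) z e v &
        forall v, \sum_(e : edge G | (v \in val e) && (e != f)) z e v
          = if v \in val f then 0 else 1 - x v].
Proof.
move=> iso x_ge0 x_lt slack_ge0.
have w_ge0 e : 0 <= weightG x e := ltW (edge_weight_gt0 card_edge x_lt e).
have [st stP] := choice (fun e => let: ex_intro a (ex_intro b h) := edge_ends e in
  ex_intro (fun q : G * G => q.1 != q.2 /\ val e = [set q.1; q.2]) (a, b)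
    (let: And3 _ ab E := h in conj ab E)).
pose src e := (st e).1; pose tgt e := (st e).2.
pose s v := if v \in val f then 0 else 1 - x v.
pose l := [seq e <- index_enum (edge G) | e != f].
have inner_sub S e : inner src tgt S e = (val e \subset S).
  by have [_ ->] := stP e; rewrite subUset !sub1set.
have ul : uniq l by rewrite filter_uniq // index_enum_uniq.
have [|z [z01 load]] := @fractional_orientation _ _ _ src tgt _ w_ge0 s l ul.
  move=> S; rewrite /surplus big_filter_cond /=.
  have U1 : (1 < #|val f :|: S|)%N.
    by apply: leq_trans (subset_leq_card (subsetUl _ _)); rewrite card_edge.
  have := slack_ge0 _ U1; rewrite /slack.
  have -> : \sum_(v in val f :|: S) (1 - x v)
      = \sum_(v in S) s v + 1 + weightG x f.
    rewrite (big_setID (val f)) /= setUK setDUl setDv set0U.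
    rewrite sumrB sumr_const card_edge /edge_weight.
    have -> : \sum_(v in S) s v = \sum_(v in S :\: val f) (1 - x v).
      rewrite (big_setID (val f)) /= big1 ?add0r; last first.
        by move=> v /setIP[_ vf]; rewrite /s vf.
      by apply: eq_bigr => v /setDP[_ /negbTE vf]; rewrite /s vf.
    by rewrite [2%:R]mulr2n; lra.
  rewrite (bigD1 f) ?subsetUl //=.
  have : \sum_(e | (e != f) && inner src tgt S e) weightG x e
     <= \sum_(e : edge G | (val e \subset val f :|: S) && (e != f)) weightG x e.
    rewrite [leLHS]big_mkcond [leRHS]big_mkcond; apply: ler_sum => e _.
    rewrite inner_sub; case: (e != f); rewrite ?andbF //= andbT.
    case: (boolP (val e \subset S)) => [eS|_]; last by case: ifP.
    by rewrite (subset_trans eS (subsetUr _ _)).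
  lra.
have incident v : exists e : edge G, v \in val e.
  have [w vw] := iso v; have [e Ee] := edge_of_adj vw.
  by exists e; rewrite Ee !inE eqxx.
have [inc incP] := choice incident.
pose zz e v := (if src e == v then z e else 0)
  + (if tgt e == v then weightG x e - z e else 0).
have zz_ge0 e v : 0 <= zz e v.
  by have /andP[? ?] := z01 e; rewrite addr_ge0 //; case: ifP; rewrite ?subr_ge0.
have zz_load v : \sum_(e : edge G | (v \in val e) && (e != f)) zz e v <= s v.
  apply: le_trans (load v); rewrite /l !big_filter_cond /=.
  rewrite big_split /= le_eqVlt; apply/orP; left; apply/eqP; congr (_ + _).
    rewrite [LHS]big_mkcond [RHS]big_mkcond /=; apply: eq_bigr => e _.
    have [_ ->] := stP e; rewrite !inE -/(src e) ![v == _]eq_sym.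
    by case: eqP; case: (e != f); rewrite ?andbT ?andbF /= ?if_same.
  rewrite [LHS]big_mkcond [RHS]big_mkcond /=; apply: eq_bigr => e _.
  have [_ ->] := stP e; rewrite !inE -/(src e) -/(tgt e) ![v == _]eq_sym.
  by case: (tgt e == v); case: (e != f); rewrite ?orbT ?andbT ?andbF /= ?if_same.
(* At the ends of [f] this remainder is 0, so the case [inc v = f] is harmless. *)
pose ex v := s v - \sum_(e : edge G | (v \in val e) && (e != f)) zz e v.
have ex_ge0 v : 0 <= ex v by rewrite subr_ge0.
exists (fun e v => zz e v + (if inc v == e then ex v else 0)); split.
- by move=> e v; rewrite addr_ge0 //; case: ifP.
- move=> e _; rewrite big_split /=.
  have : 0 <= \sum_(v in val e) (if inc v == e then ex v else 0).
    by apply: sumr_ge0 => v _; case: ifP.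
  have : \sum_(v in val e) zz e v = weightG x e.
    have [st_e ->] := stP e; rewrite -/(src e) -/(tgt e) in st_e *.
    rewrite big_setU1 ?inE //= big_set1 /zz !eqxx.
    by rewrite (negbTE st_e) eq_sym (negbTE st_e); lra.
  lra.
move=> v; rewrite big_split /= -/(s v).
have [vf|vf] := boolP (v \in val f).
  have sv : s v = 0 by rewrite /s vf.
  have load0 : \sum_(e : edge G | (v \in val e) && (e != f)) zz e v = 0.
    by apply/eqP; rewrite eq_le sumr_ge0 // andbT; have := zz_load v; rewrite sv.
  by rewrite load0 add0r big1 // => e _; rewrite /ex load0 sv subr0 if_same.
have inc_f : inc v != f by apply: contraNneq vf => <-.
have -> : \sum_(e : edge G | (v \in val e) && (e != f))
    (if inc v == e then ex v else 0) = ex v.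
  rewrite (bigD1 (inc v)) ?incP ?inc_f //= eqxx big1 ?addr0 //.
  by move=> e /andP[_ /negbTE]; rewrite eq_sym => ->.
by rewrite /ex /s (negbTE vf); lra.
Qed.

Lemma slack_Qorient (x : G -> R) : no_isolated G ->
  (forall v, 0 <= x v) -> (forall v, x v < 2^-1) ->
  (forall S : {set G}, (1 < #|S|)%N -> 0 <= slackG x S) ->
  exists2 p : orient_space R G, Qorient' R G p & forall v, p.1 v = x v.
Proof.
move=> iso x_ge0 x_lt slack_ge0.
have [z zP] := choice (fun f => transport f iso x_ge0 x_lt slack_ge0).
(* The constraint of a vertex reads the variables at the opposite ends, so [Y] is [z] with the ends
   exchanged; the sum has one term. The variables of [f] are absent from its total constraint; the
   value 1 meets the edge constraint of [f] and the vertex constraints at its ends. *)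
pose Y (f e : edge G) (w : G) := if e == f then 1 else \sum_(u in val e | u != w) z f e u.
have z_ge0 f e v : 0 <= z f e v by have [] := zP f.
pose p : orient_space R G :=
  ([ffun v => x v : R^o],
   [ffun fh => Y fh.1 (flag_edge fh.2) (flag_vertex fh.2) : R^o]).
have pE v : p.1 v = x v by rewrite ffunE.
have pY f h : p.2 (f, h) = Y f (flag_edge h) (flag_vertex h) by rewrite ffunE.
have pick (a b : G) (F : G -> R) : a != b ->
    \sum_(u in [set a; b] | u != a) F u = F b.
  move=> ab; rewrite (big_pred1 b) // => u; rewrite !inE.
  by case: (eqVneq u a) => [->|]; rewrite ?(negbTE ab) ?andbT ?andbF.
have Y_ends (f e : edge G) (a b : G) : e != f -> a != b -> val e = [set a; b] -> Y f e a = z f e b.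
  by move=> ef ab Ee; rewrite /Y (negbTE ef) Ee pick.
have sumY (f e : edge G) : e != f -> \sum_(w in val e) Y f e w = \sum_(u in val e) z f e u.
  move=> ef; have [a [b [_ ab Ee]]] := edge_ends e.
  have ba : b != a by rewrite eq_sym.
  have Ee' : val e = [set b; a] by rewrite setUC.
  rewrite Ee !big_setU1 ?inE //= !big_set1.
  by rewrite (Y_ends f e a b) // (Y_ends f e b a) // addrC.
have Y_ge0 f e w : 0 <= Y f e w.
  by rewrite /Y; case: ifP => // _; apply: sumr_ge0.
have sumE (f e : edge G) : \sum_(h | flag_edge h == e) p.2 (f, h) = \sum_(w in val e) Y f e w.
  under eq_bigr => h _ do rewrite pY.
  rewrite (flag_sum (fun e' _ => e' == e)) (bigD1 e) //= [X in _ + X]big1 ?addr0.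
    by apply: eq_bigl => w; rewrite eqxx andbT.
  by move=> e' /negbTE e'e; rewrite big_pred0 // => w; rewrite e'e andbF.
exists p => //; split.
- move=> e f; rewrite sumE; under eq_bigr => v _ do rewrite pE.
  have [->|ef] := eqVneq e f; last first.
    by have [_ /(_ e ef) + _] := zP f; rewrite sumY // /edge_weight; lra.
  have : 0 <= \sum_(v in val f) x v by apply: sumr_ge0.
  rewrite [X in _ + X](eq_bigr (fun=> 1)); last by move=> w _; rewrite /Y eqxx.
  by rewrite sumr_const card_edge; lra.
- move=> v f; under eq_bigr => h _ do rewrite pY.
  rewrite (flag_sum (fun e w => (v \in val e) && (w != v))) pE.
  have sum_e (e : edge G) : v \in val e -> e != f ->
      \sum_(w | (w \in val e) && ((v \in val e) && (w != v))) Y f e w = z f e v.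
    move=> ve ef; rewrite ve.
    have [a [b [_ ab Ee]]] := edge_ends e.
    have ba : b != a by rewrite eq_sym.
    have Ee' : val e = [set b; a] by rewrite setUC.
    move: ve; rewrite {1}Ee !inE => /orP[/eqP ->|/eqP ->].
      by rewrite Ee pick // (Y_ends f e b a).
    by rewrite Ee' pick // (Y_ends f e a b).
  have [_ _ /(_ v)] := zP f; have [vf _|vf zv] := boolP (v \in val f).
    rewrite (bigD1 f) //=.
    have [w /andP[wf wv]] : exists w, (w \in val f) && (w != v).
      have [a [b [_ ab Ef]]] := edge_ends f; rewrite Ef.
      by have [->|av] := eqVneq v a; [exists b | exists a]; rewrite !inE eqxx ?orbT //= eq_sym.
    rewrite (bigD1 w) ?wf ?vf //= {1}/Y eqxx.
    have := x_ge0 v.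
    have : 0 <= \sum_(i | ((i \in val f) && ((v \in val f) && (i != v))) && (i != w)) Y f f i.
      by apply: sumr_ge0.
    have : 0 <= \sum_(i | i != f) \sum_(v0 | (v0 \in val i) && ((v \in val i) && (v0 != v))) Y f i v0.
      by apply: sumr_ge0 => e _; apply: sumr_ge0.
    by rewrite vf /=; lra.
  suff -> : \sum_(e : edge G)
      \sum_(w | (w \in val e) && ((v \in val e) && (w != v))) Y f e w = 1 - x v.
    by rewrite addrC subrK; exact: lexx.
  rewrite -zv [RHS]big_mkcond /=; apply: eq_bigr => e _.
  have [ve|ve] := boolP (v \in val e); last first.
    by rewrite big_pred0 // => w; rewrite andbF.
  have ef : e != f by apply: contraNneq vf => <-.
  by rewrite ef /= -(sum_e e ve ef) ve.
- move=> f; under eq_bigr => v _ do rewrite pE.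
  under [X in _ + X <= _]eq_bigr => h _ do rewrite pY.
  rewrite (flag_sum (fun e _ => e != f)).
  have -> : \sum_(e : edge G) \sum_(v | (v \in val e) && (e != f)) Y f e v
      = \sum_(v | v \notin val f) (1 - x v).
    transitivity (\sum_(e : edge G) \sum_(v | (v \in val e) && (e != f)) z f e v).
      apply: eq_bigr => e _; have [ef|ef] := boolP (e != f).
        have red F : \sum_(v | (v \in val e) && true) F v = \sum_(v in val e) F v :> R.
          by apply: eq_bigl => v; rewrite andbT.
        by rewrite !red sumY.
      by rewrite !big_pred0 // => v; rewrite andbF.
    rewrite (exchange_big_dep predT) //= [RHS]big_mkcond /=.
    apply: eq_bigr => v _; have [_ _ /(_ v) ->] := zP f.
    by case: (v \in val f).
  rewrite -big_split /= (eq_bigr (fun=> 1)); last by move=> v _; rewrite addrC subrK.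
  have := cardC (mem (val f)); rewrite card_edge sumr_const => cardE.
  have : (2 + #|[predC val f]|)%:R = #|G|%:R :> R by rewrite cardE.
  rewrite natrD => <-; rewrite addrC addKr; exact: lexx.
- by move=> f h; rewrite pY.
- by move=> u; rewrite pE x_ge0 /=; have := x_lt u; lra.
Qed.
End Bridge.
End Graph.

(** * Q'_orient as a finite system of affine inequalities *)

Section Affine.
Variables (R : realType) (V : lmodType R).

Lemma affine_cst (k : R) : affine (fun _ : V => k).
Proof. by move=> a b t; ring. Qed.

Lemma affineD (f g : V -> R) : affine f -> affine g -> affine (fun p => f p + g p).
Proof. by move=> hf hg a b t; rewrite hf hg; ring. Qed.

Lemma affineN (f : V -> R) : affine f -> affine (fun p => - f p).
Proof. by move=> hf a b t; rewrite hf; ring. Qed.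

Lemma affine_sum (I : finType) (P : pred I) (f : I -> V -> R) :
  (forall i, affine (f i)) -> affine (fun p => \sum_(i | P i) f i p).
Proof.
move=> hf a b t; under eq_bigr => i _ do rewrite hf.
by rewrite big_split /= -!mulr_sumr.
Qed.

End Affine.

Section System.
Variables (R : realType) (G : sgraph).
Implicit Types p q : orient_space R G.

Lemma affine_x (v : G) : affine (fun p => p.1 v : R).
Proof. by move=> a b t; rewrite /line !ffunE. Qed.

Lemma affine_y fh : affine (fun p => p.2 fh : R).
Proof. by move=> a b t; rewrite /line !ffunE. Qed.

Definition constraint : Type :=
  (edge G * edge G + G * edge G) + (edge G + edge G * flag G) + (G + G).

Definition constraint_value (i : constraint) p : R :=
  match i with
  | inl (inl (inl (e, f))) =>
      \sum_(v in val e) p.1 v + \sum_(h | flag_edge h == e) p.2 (f, h) - 1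
  | inl (inl (inr (v, f))) =>
      p.1 v + \sum_(h | (v \in val (flag_edge h)) && (flag_vertex h != v)) p.2 (f, h) - 1
  | inl (inr (inl f)) =>
      #|G|%:R - 2%:R -
        (\sum_(v | v \notin val f) p.1 v + \sum_(h | flag_edge h != f) p.2 (f, h))
  | inl (inr (inr fh)) => p.2 fh
  | inr (inl v) => p.1 v
  | inr (inr v) => 1 - p.1 v
  end.

Lemma constraint_affine i : affine (constraint_value i).
Proof.
have x_aff (P : pred G) : affine (fun p => \sum_(v | P v) p.1 v : R).
  by apply: affine_sum => v; exact: affine_x.
have y_aff f (P : pred (flag G)) : affine (fun p => \sum_(h | P h) p.2 (f, h) : R).
  by apply: affine_sum => h; exact: affine_y.
case: i => [[[[e f]|[v f]]|[f|fh]]|[v|v]] /=.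
- by do 2?apply: affineD => //; exact: affine_cst.
- by do 2?apply: affineD => //; [exact: affine_x | exact: affine_cst].
- apply: affineD; first exact: affine_cst.
  by apply: affineN; apply: affineD.
- exact: affine_y.
- exact: affine_x.
- apply: affineD; first exact: affine_cst.
  by apply: affineN; exact: affine_x.
Qed.

(** All coordinates occur among the constraint values, so the polyhedron contains no line. *)
Lemma constraint_inj p q :
  (forall i, constraint_value i p = constraint_value i q) -> p = q.
Proof.
move=> eqpq; rewrite [p]surjective_pairing [q]surjective_pairing; congr (_, _).
  by apply/ffunP => v; exact: (eqpq (inr (inl v))).
by apply/ffunP => fh; exact: (eqpq (inl (inr (inr fh)))).
Qed.

Lemma Qorient_polyhedron : Qorient' R G = polyhedron constraint_value.
Proof.
apply/seteqP; split=> p.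
  move=> [eQ vQ tQ yQ xQ] [[[[e f]|[v f]]|[f|[f h]]]|[v|v]] /=; rewrite ?subr_ge0 //.
  - exact: eQ.
  - exact: tQ.
  - by have /andP[] := xQ v.
  - by have /andP[] := xQ v.
move=> pQ; split.
- by move=> e f; rewrite -subr_ge0; exact: (pQ (inl (inl (inl (e, f))))).
- by move=> v f; rewrite -subr_ge0; exact: (pQ (inl (inl (inr (v, f))))).
- by move=> f; rewrite -subr_ge0; exact: (pQ (inl (inr (inl f)))).
- by move=> f h; exact: (pQ (inl (inr (inr (f, h))))).
- move=> u; have xu := pQ (inr (inl u)); have := pQ (inr (inr u)).
  by rewrite /= subr_ge0 => ->; rewrite andbT.
Qed.

Lemma Qorient_nonempty : exists p, Qorient' R G p.
Proof.
exists ([ffun=> 1], [ffun=> 0]); split=> /=.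
- move=> e f; under eq_bigr => v _ do rewrite ffunE.
  under [X in _ + X]eq_bigr => h _ do rewrite ffunE.
  by rewrite sumr_const card_edge big1 //; lra.
- by move=> v f; rewrite ffunE lerDl sumr_ge0 // => h _; rewrite ffunE.
- move=> f; under eq_bigr => v _ do rewrite ffunE.
  under [X in _ + X <= _]eq_bigr => h _ do rewrite ffunE.
  rewrite [X in _ + X]big1 // addr0 sumr_const.
  have := cardC (mem (val f)); rewrite card_edge => <-.
  by rewrite natrD addrC addKr; exact: lexx.
- by move=> f h; rewrite ffunE.
- by move=> u; rewrite ffunE ler01 lexx.
Qed.

Lemma cost_affine (c : G -> R) : affine (cost c : orient_space R G -> R).
Proof.
move=> a b t; rewrite /cost !mulr_sumr -big_split /=; apply: eq_bigr => v _.
by rewrite affine_x; ring.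
Qed.

Lemma sqnorm_concave (A : set (orient_space R G)) :
  concave_on A (fun p => - \sum_v (p.1 v : R) ^+ 2).
Proof.
move=> a b t _ _ /andP[t0 t1] _.
rewrite !mulrN -opprD lerN2 !mulr_sumr -big_split /=.
apply: ler_sum => v _; rewrite affine_x.
have : 0 <= t * (1 - t) * (a.1 v - b.1 v) ^+ 2.
  by rewrite mulr_ge0 ?sqr_ge0 // mulr_ge0 // subr_ge0.
nra.
Qed.

(** The direction given by [light_point_direction] for the cycle fixes zero coordinates and tight
    slacks; a short step either way keeps the remaining inequalities, and [slack_Qorient] lifts the
    result. *)
Lemma light_point_perturbation p : has_cycle G -> no_isolated G ->
  Qorient' R G p -> (forall v, p.1 v < 2^-1) ->
  exists d : G -> R, (exists v, d v != 0) /\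
    exists p1 p2, [/\ Qorient' R G p1, Qorient' R G p2,
      forall v, p1.1 v = p.1 v + d v & forall v, p2.1 v = p.1 v - d v].
Proof.
move=> [s [s2 cyc]] iso Qp x_lt; pose x v : R := p.1 v.
have x_ge0 v : 0 <= x v by case: Qp => _ _ _ _ /(_ v)/andP[].
have slack_ge0 := Qorient_slack Qp x_lt.
have dS := cycle_deg s2 cyc.
have S1 : (1 < #|[set w in s]|)%N.
  case/andP: cyc => _ us; rewrite cardsE; move/card_uniqP: us => ->; exact: ltnW.
have [d [d_nz d_supp d_tight]] := light_point_direction (@card_edge G) x_ge0 x_lt slack_ge0 S1 dS.
pose slackG := slack (R := R) (fun e : edge G => val e).
pose slopeG (S : {set G}) := \sum_(v in S) ((deg (fun e : edge G => val e) S v)%:R - 1) * d v.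
(* The value 1 is a dummy for zero coordinates and tight sets, where the drift is 0, and for sets
   with fewer than two vertices, which carry no condition. *)
pose room (i : G + {set G}) : R := match i with
  | inl v => if x v == 0 then 1 else Num.min (x v) (2^-1 - x v)
  | inr T => if (1 < #|T|)%N && (slackG x T != 0) then slackG x T else 1 end.
pose drift (i : G + {set G}) : R :=
  match i with inl v => d v | inr T => slopeG T end.
have room_gt0 i : 0 < room i.
  case: i => [v|S] /=; case: ifP => //.
    by move=> /negbT xv; rewrite lt_min subr_gt0 x_lt andbT lt_neqAle eq_sym xv x_ge0.
  by case/andP=> S2 nz; rewrite lt_neqAle eq_sym nz slack_ge0.
have [eps eps0 small] := uniform_small_step drift room_gt0.
have feasible delta : `|delta| = eps ->
    exists2 q, Qorient' R G q & forall v, q.1 v = x v + delta * d v.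
  move=> Edelta.
  have bound i : `|delta * drift i| < room i by rewrite normrM Edelta.
  apply: slack_Qorient => //.
  - move=> v; have := bound (inl v); rewrite /= ltr_norml => /andP[].
    have [xv|xv] := eqVneq (x v) 0; first by rewrite (d_supp v xv) mulr0 xv addr0.
    have : Num.min (x v) (2^-1 - x v) <= x v by rewrite ge_min lexx.
    lra.
  - move=> v; have := bound (inl v); rewrite /= ltr_norml => /andP[].
    have [xv|xv] := eqVneq (x v) 0; first by move=> _ _; rewrite (d_supp v xv) mulr0 addr0; exact: x_lt.
    have : Num.min (x v) (2^-1 - x v) <= 2^-1 - x v by rewrite ge_min lexx orbT.
    lra.
  - move=> S S2; rewrite (slack_shift (@card_edge G)).
    have -> : \sum_(v in S) ((deg (fun e : edge G => val e) S v)%:R - 1) * (delta * d v)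
        = delta * slopeG S.
      by rewrite mulr_sumr; apply: eq_bigr => v _; ring.
    have := bound (inr S); rewrite /= S2 /=.
    have [S0 _|nz] := eqVneq (slackG x S) 0; last first.
      by rewrite ltr_norml /slackG => /andP[]; lra.
    have := d_tight S; rewrite /tight S2 -/slackG S0 eqxx => /(_ isT).
    by rewrite /slopeG => ->; rewrite mulr0 addr0; exact: lexx.
have [p1 Q1 E1] := feasible eps (gtr0_norm eps0).
have [|p2 Q2 E2] := feasible (- eps); first by rewrite normrN gtr0_norm.
exists (fun v => eps * d v); split.
  by case: d_nz => v dv; exists v; exact: mulf_neq0 (lt0r_neq0 eps0) dv.
by exists p1, p2; split=> // v; rewrite E2 mulNr.
Qed.

End System.

Theorem corollary4 (R : realType) (G : sgraph)
    (Gcycle : has_cycle G) (Giso : no_isolated G)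
    (c : G -> R) (c_ge0 : forall v, 0 <= c v) :
  exists p : orient_space R G,
    [/\ extreme_point (Qorient' R G) p,
        optimal (cost c) (Qorient' R G) p &
        exists v : G, 2^-1 <= p.1 v].
Proof.
pose sqnorm (p : orient_space R G) : R := \sum_v (p.1 v : R) ^+ 2.
have cost_ge0 p : polyhedron (constraint_value (G := G)) p -> 0 <= cost c p.
  rewrite -Qorient_polyhedron => -[_ _ _ _ x01].
  by apply: sumr_ge0 => v _; rewrite mulr_ge0 //; have /andP[] := x01 v.
have sqnorm_le p : polyhedron (constraint_value (G := G)) p ->
    - #|G|%:R <= - sqnorm p.
  rewrite -Qorient_polyhedron => -[_ _ _ _ x01]; rewrite lerN2 -sumr_const.
  by apply: ler_sum => v _; have /andP[? ?] := x01 v; rewrite expr_le1.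
have := @lex_min_extreme _ _ _ _ (cost c) (fun p => - sqnorm p) _ _
  (@constraint_affine R G) (@constraint_inj R G) (cost_affine c) cost_ge0
  (@sqnorm_concave R G _) sqnorm_le.
rewrite -Qorient_polyhedron => /(_ (Qorient_nonempty R G))[p [xp opt sq_max]].
have Qp := proj1 xp; exists p; split=> //.
have [//|light] := pselect (exists v : G, 2^-1 <= p.1 v).
have x_lt v : p.1 v < 2^-1.
  by rewrite ltNge; apply/negP => ge; apply: light; exists v.
have [d [[v0 dv0] [p1 [p2 [Q1 Q2 E1 E2]]]]] :=
  light_point_perturbation Gcycle Giso Qp x_lt.
(* The [x]-part of [p] is the midpoint of those of [p1] and [p2]: both are optimal by linearity, and
   the parallelogram law makes one of them longer, against the choice of [p]. *)
have cost12 : cost c p1 + cost c p2 = 2 * cost c p.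
  rewrite /cost mulr_sumr -big_split /=; apply: eq_bigr => v _.
  by rewrite E1 E2; ring.
have sq12 : sqnorm p1 + sqnorm p2 = 2 * sqnorm p + 2 * \sum_v d v ^+ 2.
  rewrite /sqnorm !mulr_sumr -!big_split /=; apply: eq_bigr => v _.
  by rewrite E1 E2; ring.
have c1 := opt _ Q1; have c2 := opt _ Q2.
have := sq_max _ Q1; have := sq_max _ Q2.
have d_pos : 0 < \sum_v d v ^+ 2.
  rewrite (bigD1 v0) //= ltr_pwDl ?exprn_even_gt0 ?dv0 //.
  by apply: sumr_ge0 => v _; exact: sqr_ge0.
have c1' : cost c p1 <= cost c p by lra.
have c2' : cost c p2 <= cost c p by lra.
move=> /(_ c2') s2 /(_ c1') s1; lra.
Qed.
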